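(* Fix an integer $p\geq 1$, integers $r_1,\ldots,r_p\geq 0$ and real numbers $0\leq t_0<t_1<\cdots<t_p$. For each $i=1,\ldots,p$ and each $n\geq 1$, let $$M_i(n)=n^{-r_i/2}\sum(0\,a_1\cdots a_{r_i})\in\mathbb{C}[\mathcal{S}],$$ where the sum runs over all $r_i$-tuples $(a_1,\ldots,a_{r_i})$ of pairwise distinct integers of $(nt_{i-1},nt_i]$. Then $M_1(n),\ldots,M_p(n)$ are asymptotically free as $n$ goes to infinity.
   Context: $\mathcal{S}$ is the group of finitely supported permutations of the set of nonnegative integers. $\mathbb{C}[\mathcal{S}]$ is its group algebra, with involution $(\sum_\sigma x_\sigma\sigma)^*=\sum_\sigma\overline{x_\sigma}\sigma^{-1}$ and canonical trace $\varphi(\sum_\sigma x_\sigma\sigma)=x_{\mathrm{id}}$, where $\mathrm{id}$ is the identity permutation. $(0\,a_1\cdots a_r)$ denotes the cycle $0\to a_1\to\cdots\to a_r\to0$; for $r=0$ the sum is just the identity permutation $\mathrm{id}$. The non-commutative distribution of self-adjoint elements $x_1,\ldots,x_p$ of a non-commutative probability space $(\mathcal{A},\varphi)$ is the map sending each polynomial $P$ in $p$ non-commuting variables to $\varphi(P(x_1,\ldots,x_p))$. The elements $M_1(n),\ldots,M_p(n)$ are asymptotically free as $n\to\infty$ if their joint non-commutative distribution converges pointwise (on every such $P$) to the non-commutative distribution of a family of $p$ free elements of some non-commutative probability space. *)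

(* Defs.v *)
From HB Require Import structures.
From mathcomp Require Import all_boot all_order all_algebra finmap.
From mathcomp Require Import complex monalg.
From mathcomp Require Import boolp classical_sets reals topology normedtype.
From mathcomp Require Import sequences exp.

Set Implicit Arguments.
Unset Strict Implicit.
Unset Printing Implicit Defensive.

Import Order.TTheory GRing.Theory Num.Theory numFieldNormedType.Exports.

Local Open Scope fset_scope.
Local Open Scope ring_scope.

(* The linear form is a tracial state, as is the canonical trace of a group   *)
(* algebra.                                                                   *)
HB.mixin Record Algebra_isNCProbSpace (C : numClosedFieldType) A
    of GRing.Algebra C A := {
  adj : A -> A;
  nctrace : {scalar A};
  adjK : involutive adj;
  adj_antilinear : forall (c : C) (x y : A),
    adj (c *: x + y) = (c^*)%R *: adj x + adj y;
  adjM : forall x y : A, adj (x * y) = adj y * adj x;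
  nctrace1 : nctrace 1 = 1;
  nctrace_ge0 : forall x : A, 0 <= nctrace (adj x * x);
  nctrace_tracial : forall x y : A, nctrace (x * y) = nctrace (y * x)
}.

#[short(type="ncProbSpaceType")]
HB.structure Definition NCProbSpace (C : numClosedFieldType) :=
  { A of Algebra_isNCProbSpace C A & GRing.Algebra C A }.

Section NCDistribution.
Context {C : numClosedFieldType} {A : ncProbSpaceType C} {p : nat}.

(* Polynomials in p non-commuting variables are elements of the algebra of    *)
(* the free monoid on 'I_p; a word [:: i1; ...; ik] is evaluated to the       *)
(* product x i1 * ... * x ik, in this order.                                  *)
Definition nceval (x : 'I_p -> A) (P : {malg C[{fmonom 'I_p}]}) : A :=
  mmap (fun c : C => c%:A) (fun w : {fmonom 'I_p} => \prod_(i <- w) x i) P.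

Definition ncdistr (x : 'I_p -> A) (P : {malg C[{fmonom 'I_p}]}) : C :=
  nctrace (nceval x P).

(* The unital subalgebra generated by x. It is stable under [adj] when x is   *)
(* self-adjoint, hence is then also the *-subalgebra generated by x.          *)
Definition gen_subalg (x a : A) : Prop :=
  exists Q : {poly C}, a = horner_alg x Q.

(* [s] is a nonempty word (i1, a1) ... (im, am) with a_j a centred element of *)
(* the subalgebra of index i_j, and i_j != i_(j+1).                           *)
Definition free_elements (x : 'I_p -> A) : Prop :=
  forall s : seq ('I_p * A),
    s != [::] ->
    (forall u, u \in s -> gen_subalg (x u.1) u.2 /\ nctrace u.2 = 0) ->
    sorted (fun u v : 'I_p * A => u.1 != v.1) s ->
    nctrace (\prod_(u <- s) u.2) = 0.

End NCDistribution.

(* The topology on C^o is the one induced by the norm of C.                   *)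
Definition asymptotically_free (C : numClosedFieldType)
    (A : ncProbSpaceType C) (p : nat) (M : nat -> 'I_p -> A) : Prop :=
  exists (B : ncProbSpaceType C) (x : 'I_p -> B),
    [/\ forall i, adj (x i) = x i,
        free_elements x &
        forall P : {malg C[{fmonom 'I_p}]},
          ((fun n => ncdistr (M n) P : C^o) @ \oo -->
             (ncdistr x P : C^o))%classic].

Record fsperm := FSPerm {
  fsperm_val :> {fsfun nat -> nat};
  fsperm_inj : fsinjectiveb fsperm_val
}.

HB.instance Definition _ := [isSub for fsperm_val].
HB.instance Definition _ := [Choice of fsperm by <:].

Lemma fspermP (f g : fsperm) : f =1 g -> f = g.
Proof. by move=> fg; apply/val_inj/fsfunP. Qed.

Lemma fsperm_injective (f : fsperm) : injective f.
Proof. exact/fsinjectiveP/fsperm_inj. Qed.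

Section FSPermGroup.

Lemma fsperm1_subproof : fsinjectiveb ([fsfun] : {fsfun nat -> nat}).
Proof. by apply/fsinjectiveP => x y; rewrite !fsfun0E. Qed.
Definition fsperm1 : fsperm := FSPerm fsperm1_subproof.

Lemma fspermM_subproof (f g : fsperm) : fsinjectiveb (fsfun_comp f g).
Proof. by apply/fsinjectiveP/fscomp_inj; exact: fsperm_injective. Qed.
Definition fspermM (f g : fsperm) : fsperm := FSPerm (fspermM_subproof f g).

Definition fspermV_fun (f : fsperm) : {fsfun nat -> nat} :=
  [fsfun y in finsupp f => head y [seq x <- finsupp f | f x == y]].

Lemma fspermV_funK (f : fsperm) : cancel (fspermV_fun f) f.
Proof.
move=> y; rewrite fsfunE; case: ifP => [yf|/negbT yf]; last exact: fsfun_dflt.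
have := yf; rewrite -{1}(imfset_eq_fsinjectiveP (fsperm_inj f)).
move=> /imfsetP[x /= xf yE].
case E: [seq z <- finsupp f | f z == y] => [|z s] /=.
  have : x \in [seq z <- finsupp f | f z == y] by rewrite mem_filter -yE eqxx.
  by rewrite E.
have : z \in [seq z <- finsupp f | f z == y] by rewrite E mem_head.
by rewrite mem_filter => /andP[/eqP].
Qed.

Lemma fspermV_subproof (f : fsperm) : fsinjectiveb (fspermV_fun f).
Proof. exact/fsinjectiveP/can_inj/fspermV_funK. Qed.
Definition fspermV (f : fsperm) : fsperm := FSPerm (fspermV_subproof f).

Lemma fspermMA : associative fspermM.
Proof. by move=> f g h; apply: val_inj => /=; apply: fscompA. Qed.
Lemma fsperm1M : left_id fsperm1 fspermM.
Proof. by move=> f; apply: val_inj => /=; apply: fscomp0f. Qed.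
Lemma fspermM1 : right_id fsperm1 fspermM.
Proof. by move=> f; apply/fspermP => x; rewrite /= fscompE /= fsfun0E. Qed.
Lemma fspermMV : right_inverse fsperm1 fspermV fspermM.
Proof.
by move=> f; apply/fspermP => x; rewrite /= fscompE /= fsfun0E fspermV_funK.
Qed.
Lemma fspermVM : left_inverse fsperm1 fspermV fspermM.
Proof.
move=> f; apply/fspermP => x; rewrite /= fscompE /= fsfun0E.
by apply: (@fsperm_injective f); rewrite fspermV_funK.
Qed.

HB.instance Definition _ := isGroup.Build fsperm
  fspermMA fsperm1M fspermM1 fspermVM fspermMV.

End FSPermGroup.

(* For a duplicate-free s = [:: x0; ...; xr] this is the cycle                *)
(* x0 -> x1 -> ... -> xr -> x0; [undup] makes it a permutation for every s.   *)
Definition cycle_fun (s : seq nat) : {fsfun nat -> nat} :=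
  [fsfun x in [fset x in s] => next (undup s) x].

Lemma cycle_funE (s : seq nat) : cycle_fun s =1 next (undup s).
Proof.
move=> x; rewrite fsfunE !inE -mem_undup; case: (undup s) => [|y t] //=.
case: ifPn => // /[!inE] /norP[xy].
elim: t {1 3}y xy => [|z t IHt] w /negbTE xw /=; rewrite xw //.
by rewrite inE => /norP[xz]; apply: IHt.
Qed.

Lemma cycle_subproof (s : seq nat) : fsinjectiveb (cycle_fun s).
Proof.
apply/fsinjectiveP => x y; rewrite !cycle_funE.
exact: (can_inj (prev_next (undup_uniq s))).
Qed.

Definition cycle_perm (s : seq nat) : fsperm := FSPerm (cycle_subproof s).

Lemma cycle_permE (s : seq nat) : uniq s -> cycle_perm s =1 next s.
Proof. by move=> us x; rewrite /= cycle_funE undup_id. Qed.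

Lemma cycle_permV (x : nat) (s : seq nat) : uniq (x :: s) ->
  ((cycle_perm (x :: s))^-1)%g = cycle_perm (x :: rev s).
Proof.
move=> us; have urs : uniq (x :: rev s) by rewrite /= mem_rev rev_uniq.
apply: (mulgI (cycle_perm (x :: s))); rewrite mulgV; apply/esym/fspermP => y.
have -> : (cycle_perm (x :: s) * cycle_perm (x :: rev s))%g y
  = cycle_perm (x :: s) (cycle_perm (x :: rev s) y) by rewrite /= fscompE.
rewrite !cycle_permE // [RHS]fsfun0E.
rewrite -(next_rot 1 urs) rot1_cons -rev_cons next_rev //.
exact: next_prev.
Qed.

Definition galg (C : numClosedFieldType) (G : groupType) := {malg C[G]}.

Section GroupAlgebra.
Context {C : numClosedFieldType} {G : groupType}.
Local Notation A := (galg C G).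
Implicit Types (x y z : A) (g h : G) (c : C).

HB.instance Definition _ := GRing.Lmodule.on A.

Definition galg_one : A := << 1%g >>.

Definition galg_mul x y : A :=
  \sum_(g <- msupp x) \sum_(h <- msupp y) << x@_g * y@_h *g (g * h)%g >>.

Lemma galg_mulw (d1 d2 : {fset G}) x y :
  msupp x `<=` d1 -> msupp y `<=` d2 ->
  galg_mul x y =
    \sum_(g <- d1) \sum_(h <- d2) << x@_g * y@_h *g (g * h)%g >>.
Proof.
move=> le1 le2; rewrite /galg_mul (big_fset_incl _ le1) /=.
  apply/eq_bigr => g _; apply/big_fset_incl => // h _ /mcoeff_outdom ->.
  by rewrite mulr0 monalgU0.
move=> g _ /mcoeff_outdom xg.
by rewrite big1 // => h _; rewrite xg mul0r monalgU0.
Qed.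

Lemma galg_mulUU c c' g h :
  galg_mul << c *g g >> << c' *g h >> = << c * c' *g (g * h)%g >>.
Proof. by rewrite (galg_mulw msuppU_le msuppU_le) !big_seq_fset1 !mcoeffUU. Qed.

Lemma galg_mulDl : left_distributive galg_mul +%R.
Proof.
move=> x y z.
rewrite (galg_mulw (msuppD_le x y) (fsubset_refl _)).
rewrite (galg_mulw (fsubsetUl (msupp x) (msupp y)) (fsubset_refl _)).
rewrite (galg_mulw (fsubsetUr (msupp x) (msupp y)) (fsubset_refl _)).
rewrite -big_split /=; apply/eq_bigr => g _.
rewrite -big_split /=; apply/eq_bigr => h _.
by rewrite mcoeffD mulrDl monalgUD.
Qed.

Lemma galg_mulDr : right_distributive galg_mul +%R.
Proof.
move=> x y z.
rewrite (galg_mulw (fsubset_refl _) (msuppD_le y z)).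
rewrite (galg_mulw (fsubset_refl _) (fsubsetUl (msupp y) (msupp z))).
rewrite (galg_mulw (fsubset_refl _) (fsubsetUr (msupp y) (msupp z))).
rewrite -big_split /=; apply/eq_bigr => g _.
rewrite -big_split /=; apply/eq_bigr => h _.
by rewrite mcoeffD mulrDr monalgUD.
Qed.

Lemma galg_mul0l : left_zero 0 galg_mul.
Proof. by move=> x; rewrite /galg_mul msupp0 big_seq_fset0. Qed.

Lemma galg_mul0r : right_zero 0 galg_mul.
Proof.
by move=> x; rewrite /galg_mul big1 // => g _; rewrite msupp0 big_seq_fset0.
Qed.

Lemma galg_suml (I : Type) (r : seq I) (F : I -> A) y :
  galg_mul (\sum_(i <- r) F i) y = \sum_(i <- r) galg_mul (F i) y.
Proof.
exact: (big_morph (galg_mul^~ y) (fun _ _ => galg_mulDl _ _ _) (galg_mul0l _)).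
Qed.

Lemma galg_sumr (I : Type) (r : seq I) (F : I -> A) x :
  galg_mul x (\sum_(i <- r) F i) = \sum_(i <- r) galg_mul x (F i).
Proof.
exact: (big_morph (galg_mul x) (fun _ _ => galg_mulDr _ _ _) (galg_mul0r _)).
Qed.

Lemma galg_mul1l : left_id galg_one galg_mul.
Proof.
move=> x; rewrite [x in LHS]monalgE galg_sumr [RHS]monalgE.
by apply/eq_bigr => g _; rewrite galg_mulUU mul1r mul1g.
Qed.

Lemma galg_mul1r : right_id galg_one galg_mul.
Proof.
move=> x; rewrite [x in LHS]monalgE galg_suml [RHS]monalgE.
by apply/eq_bigr => g _; rewrite galg_mulUU mulr1 mulg1.
Qed.

Lemma galg_mulEl x y :
  galg_mul x y = \sum_(g <- msupp x) galg_mul << x@_g *g g >> y.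
Proof. by rewrite -galg_suml -monalgE. Qed.

Lemma galg_mulEr x y :
  galg_mul x y = \sum_(h <- msupp y) galg_mul x << y@_h *g h >>.
Proof. by rewrite -galg_sumr -monalgE. Qed.

Lemma galg_mulA : associative galg_mul.
Proof.
move=> x y z; rewrite (galg_mulEl x) (galg_mulEl x y) galg_suml.
apply/eq_bigr => g _.
rewrite (galg_mulEl y) (galg_mulEr _ y) galg_sumr galg_suml.
apply/eq_bigr => h _.
rewrite (galg_mulEr _ z) galg_sumr [RHS]galg_mulEr; apply/eq_bigr => k _.
by rewrite !galg_mulUU mulrA mulgA.
Qed.

Lemma galg_oner_neq0 : galg_one != 0.
Proof. by apply/eqP/malgP => /(_ 1%g) /eqP; rewrite !mcoeffsE oner_eq0. Qed.

HB.instance Definition _ := GRing.Zmodule_isNzRing.Build A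
  galg_mulA galg_mul1l galg_mul1r galg_mulDl galg_mulDr galg_oner_neq0.

Lemma galg_scaleU c c' g : c *: << c' *g g >> = << c * c' *g g >> :> A.
Proof.
by apply/malgP => h; rewrite mcoeffZ !mcoeffU mulrnAr.
Qed.

Lemma galg_scaleAl c x y : c *: (x * y) = (c *: x) * y.
Proof.
rewrite [RHS](galg_mulw (msuppZ_le c x) (fsubset_refl _)) scaler_sumr.
apply/eq_bigr => g _; rewrite scaler_sumr; apply/eq_bigr => h _.
by rewrite galg_scaleU mcoeffZ mulrA.
Qed.

Lemma galg_scaleAr c x y : c *: (x * y) = x * (c *: y).
Proof.
rewrite [RHS](galg_mulw (fsubset_refl _) (msuppZ_le c y)) scaler_sumr.
apply/eq_bigr => g _; rewrite scaler_sumr; apply/eq_bigr => h _.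
by rewrite galg_scaleU mcoeffZ mulrCA.
Qed.

HB.instance Definition _ := GRing.Lmodule_isLalgebra.Build C A galg_scaleAl.
HB.instance Definition _ := GRing.Lalgebra_isAlgebra.Build C A galg_scaleAr.

Definition galg_adj x : A := \sum_(g <- msupp x) << (x@_g)^*%R *g (g^-1)%g >>.

Definition galg_trace x : C := x@_1%g.

Lemma galg_adjE x g : (galg_adj x)@_g = (x@_(g^-1)%g)^*%R.
Proof.
rewrite raddf_sum /=; under eq_bigr do rewrite mcoeffU.
have [xg|xg] := msuppP x (g^-1)%g.
  rewrite (big_fsetD1 (g^-1)%g) //= invgK eqxx mulr1n big_seq big1 ?addr0 //.
  move=> h; rewrite !inE => /andP[hg _].
  by rewrite -(inj_eq invg_inj) invgK (negbTE hg).
rewrite rmorph0 big_seq big1 // => h hx.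
rewrite -(inj_eq invg_inj) invgK; case: eqP => // hg.
by rewrite -hg hx in xg.
Qed.

Lemma galg_adjK : involutive galg_adj.
Proof. by move=> x; apply/malgP => g; rewrite !galg_adjE invgK conjCK. Qed.

Lemma galg_adj_antilinear c x y :
  galg_adj (c *: x + y) = (c^*)%R *: galg_adj x + galg_adj y.
Proof.
apply/malgP => g.
by rewrite mcoeffD mcoeffZ !galg_adjE mcoeffD mcoeffZ rmorphD rmorphM.
Qed.

Lemma galg_adjZ c x : galg_adj (c *: x) = (c^*)%R *: galg_adj x.
Proof.
by apply/malgP => g; rewrite mcoeffZ !galg_adjE mcoeffZ rmorphM.
Qed.

Lemma galg_adjU c g : galg_adj << c *g g >> = << c^*%R *g (g^-1)%g >>.
Proof.
apply/malgP => h; rewrite galg_adjE !mcoeffU rmorphMn /=.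
by rewrite -(inj_eq invg_inj) invgK.
Qed.

Lemma galg_adj_sum (I : Type) (r : seq I) (F : I -> A) :
  galg_adj (\sum_(i <- r) F i) = \sum_(i <- r) galg_adj (F i).
Proof.
apply: big_morph => [x y|].
  by have := galg_adj_antilinear 1 x y; rewrite rmorph1 !scale1r.
by rewrite /galg_adj msupp0 big_seq_fset0.
Qed.

Lemma galg_adjM x y : galg_adj (x * y) = galg_adj y * galg_adj x.
Proof.
rewrite [LHS]galg_adj_sum [RHS]galg_sumr; apply/eq_bigr => g _.
rewrite galg_adj_sum [RHS]galg_suml; apply/eq_bigr => h _.
by rewrite galg_adjU galg_mulUU rmorphM mulrC invgM.
Qed.

Lemma galg_trace_linear : linear_for *%R galg_trace.
Proof. by move=> c x y; rewrite /galg_trace mcoeffD mcoeffZ. Qed.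

HB.instance Definition _ :=
  GRing.isLinear.Build C A C *%R galg_trace galg_trace_linear.

Lemma galg_trace1 : galg_trace 1 = 1.
Proof. by rewrite /galg_trace mcoeffUU. Qed.

Lemma galg_traceM x y :
  galg_trace (x * y) = \sum_(h <- msupp y) x@_(h^-1)%g * y@_h.
Proof.
rewrite /galg_trace {1}/GRing.mul /= /galg_mul exchange_big raddf_sum /=.
apply/eq_bigr => h _; rewrite raddf_sum /=.
under eq_bigr => g do rewrite mcoeffU mulg_eq1.
have [xh|xh] := msuppP x (h^-1)%g.
  rewrite (big_fsetD1 (h^-1)%g) //= eqxx mulr1n big_seq big1 ?addr0 //.
  by move=> g; rewrite !inE => /andP[/negbTE-> _].
rewrite mul0r big_seq big1 // => g gx; case: eqP => // hg.
by rewrite -hg gx in xh.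
Qed.

Lemma galg_trace_ge0 x : 0 <= galg_trace (galg_adj x * x).
Proof.
rewrite galg_traceM sumr_ge0 // => g _.
by rewrite galg_adjE invgK mulrC mul_conjC_ge0.
Qed.

Lemma galg_traceC x y : galg_trace (x * y) = galg_trace (y * x).
Proof.
rewrite /galg_trace /GRing.mul /= /galg_mul exchange_big !raddf_sum /=.
apply/eq_bigr => h _; rewrite !raddf_sum /=; apply/eq_bigr => g _.
by rewrite !mcoeffU mulrC !mulg_eq1 -eqg_invLR eq_sym.
Qed.

HB.instance Definition _ := Algebra_isNCProbSpace.Build C A
  galg_adjK galg_adj_antilinear galg_adjM
  galg_trace1 galg_trace_ge0 galg_traceC.

End GroupAlgebra.

(* The 'I_N only provides a finite index type: the integers of (n a, n b] are *)
(* at most the integer part of n b. For r = 0 the sum is the identity.        *)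
Definition cycle_sum (R : realType) (r : nat) (a b : R) (n : nat) :
    galg R[i] fsperm :=
  ((n%:R `^ (- (r%:R / 2)))%:C)%C *:
  \sum_(s : r.-tuple 'I_(Num.truncn (n%:R * b)).+1 |
        uniq s && all (fun k : 'I__ => n%:R * a < k%:R <= n%:R * b) s)
    << cycle_perm (0%N :: map val s) >>.

Lemma cycle_sum_adj (R : realType) (r : nat) (a b : R) (n : nat) :
  0 <= a -> adj (cycle_sum r a b n) = cycle_sum r a b n.
Proof.
move=> a_ge0; rewrite /cycle_sum; set S := \sum_(_ | _) _.
rewrite [LHS]galg_adjZ; congr (_ *: _); first exact: conjc_real.
rewrite /S -big_filter galg_adj_sum !big_filter.
pose f (s : r.-tuple 'I_(Num.truncn (n%:R * b)).+1) := [tuple of rev s].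
have fK : involutive f by move=> s; apply: val_inj; rewrite /= revK.
rewrite [RHS](reindex_inj (inv_inj fK)) /=.
apply: eq_big => [s|s /andP[us /allP sP]]; first by rewrite rev_uniq all_rev.
rewrite galg_adjU rmorph1 map_rev cycle_permV //=.
rewrite (map_inj_uniq val_inj) us andbT; apply/mapP => -[k ks k0].
have /andP[+ _] := sP k ks.
by rewrite (esym k0 : nat_of_ord k = 0%N) ltNge mulr_ge0.
Qed.

(* Main.v *)
From HB Require Import structures.
From mathcomp Require Import all_boot all_order all_algebra finmap.
From mathcomp Require Import complex monalg.
From mathcomp Require Import boolp classical_sets reals topology normedtype.
From mathcomp Require Import sequences exp realfun ring.
Require Import Defs.
Import Order.TTheory GRing.Theory Num.Theory numFieldNormedType.Exports.

(* A cycle (0 a1 ... ar) is a product of star transpositions (0 a), so the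
   mixed moments of the M_i(n) count the words of N letters, with prescribed
   colours and distinctness constraints, whose product of star transpositions
   is the identity, divided by n^(N/2). Whether a word is counted depends only
   on its pattern of equalities, and a pattern with b distinct letters is
   realized about n^b times. A letter occurring once is moved by the product,
   so only patterns with 2b <= N are counted, and the moments converge.

   Subtracting its trace from M_i(n)^m amounts to removing the words whose
   product is the identity. Hence an alternating product of such centred powers
   counts words made of runs, each with a nontrivial product, but with trivial
   total product. If every letter occurred exactly twice, cancelling equal
   adjacent letters (which exist, and lie in the same run) would exhibit a run
   sharing no letter with the others; its product would then be trivial. So
   2b < N and the moment tends to 0.

   The limit elements are the variables of the free algebra, with the limit of
   the traces: positivity and traciality pass to the limit. *)

Set Implicit Arguments.
Unset Strict Implicit.
Unset Printing Implicit Defensive.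

(** * Words of star transpositions *)

Definition star_transp (a y : nat) : nat :=
  if y == 0 then a else if y == a then 0 else y.

Definition star_act (w : seq nat) (y : nat) : nat := foldr star_transp y w.

(** Only [0] and the letters of [w] can be moved, so this finite test decides whether the product is
    the identity. *)
Definition star_trivial (w : seq nat) : bool :=
  all (fun y => star_act w y == y) (0 :: w).

Lemma star_transpK a : involutive (star_transp a).
Proof.
move=> y; rewrite /star_transp.
by repeat (case: eqP => //=; try congruence).
Qed.

Lemma star_act_cat u v y : star_act (u ++ v) y = star_act u (star_act v y).
Proof. exact: foldr_cat. Qed.

Lemma star_act_rcons w a y :
  star_act (rcons w a) y = star_act w (star_transp a y).
Proof. by rewrite -cats1 star_act_cat. Qed.

Lemma star_act_inj w : injective (star_act w).
Proof.
by elim: w => //= a w IHw x y /(can_inj (star_transpK a)) /IHw.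
Qed.

Lemma star_act_out w y : y != 0 -> y \notin w -> star_act w y = y.
Proof.
move=> y0; elim: w => //= a w IHw; rewrite inE negb_or => /andP[ya /IHw ->].
by rewrite /star_transp (negbTE y0) (negbTE ya).
Qed.

Lemma star_trivialP w : reflect (star_act w =1 id) (star_trivial w).
Proof.
apply: (iffP allP) => [wP y|wP y _]; last by rewrite wP.
have [/wP/eqP//|] := boolP (y \in 0 :: w).
by rewrite inE negb_or => /andP[y0 /(star_act_out y0)].
Qed.

Lemma star_transp_map f a y : f 0 = 0 -> {in [:: 0; a; y] &, injective f} ->
  star_transp (f a) (f y) = f (star_transp a y).
Proof.
move=> f0 fI; rewrite /star_transp -[in f y == 0]f0.
rewrite !(inj_in_eq fI) ?inE ?eqxx ?orbT //.
by case: eqP => // _; case: eqP.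
Qed.

Lemma star_act_in w y : star_act w y \in 0 :: y :: w.
Proof.
elim: w => [|a w IHw] /=; first by rewrite !inE eqxx orbT.
rewrite {1}/star_transp; case: ifP => _; first by rewrite !inE eqxx !orbT.
case: ifP => // _; move: IHw; rewrite !inE.
by case/or3P => ->; rewrite ?orbT.
Qed.

Lemma star_act_map f w y : f 0 = 0 -> {in 0 :: y :: w &, injective f} ->
  star_act (map f w) (f y) = f (star_act w y).
Proof.
move=> f0; elim: w => //= a w IHw fI.
have sub z : z \in 0 :: y :: w -> z \in [:: 0, y, a & w].
  by rewrite !inE => /or3P[] ->; rewrite ?orbT.
rewrite IHw; last by move=> u v /sub u_ /sub v_; exact: fI.
apply: star_transp_map => // u v uP vP; apply: fI.
  move: uP; rewrite !inE => /or3P[] /eqP->; rewrite ?eqxx ?orbT //.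
  by have := sub _ (star_act_in w y); rewrite !inE.
move: vP; rewrite !inE => /or3P[] /eqP->; rewrite ?eqxx ?orbT //.
by have := sub _ (star_act_in w y); rewrite !inE.
Qed.

(** Such an [f] intertwines the actions of [w] and [map f w] on [0] and the letters, so triviality
    depends only on which letters coincide. *)
Lemma star_trivial_map f w : f 0 = 0 -> {in 0 :: w &, injective f} ->
  star_trivial (map f w) = star_trivial w.
Proof.
move=> f0 fI; rewrite /star_trivial.
have -> : 0 :: map f w = map f (0 :: w) by rewrite /= f0.
rewrite all_map.
apply: eq_in_all => y yw /=; rewrite star_act_map //; last first.
  move=> u v uP vP; apply: fI; [move: uP|move: vP];
  by rewrite !inE => /or3P[/eqP->|/eqP->|->]; rewrite ?eqxx ?orbT -?in_cons.
rewrite (inj_in_eq fI) //.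
have := star_act_in w y; move: yw; rewrite !inE.
by move=> yw /or3P[->|/eqP->|->] //; rewrite orbT.
Qed.

(** If [w] is [u ++ x :: v] with [x] in neither part, then [v] fixes [x] and the transposition sends
    it to [0]. Triviality makes [u] send [0] to [x], but [u] already fixes [x]. *)
Lemma star_trivial_count w x : 0 \notin w -> star_trivial w ->
  count_mem x w != 1.
Proof.
move=> w0 /star_trivialP wP; apply/eqP => cx.
have xw : x \in w by rewrite -has_pred1 has_count cx.
have x0 : x != 0 by apply: contraNneq w0 => <-.
move: xw cx wP => /splitPr[u v]; rewrite count_cat /= eqxx add1n addnS => -[].
move=> /eqP; rewrite addn_eq0 => /andP[/eqP/count_memPn xu /eqP/count_memPn xv].
move=> /(_ x); rewrite star_act_cat /= (star_act_out x0 xv) {1}/star_transp.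
rewrite (negbTE x0) eqxx -[RHS](star_act_out x0 xu) => /star_act_inj/esym/eqP.
by rewrite (negbTE x0).
Qed.

(* As [u] and the rest of the word have no letter in common, the rest of the
   word fixes the letters of [u]; hence so does [u]. *)
Lemma star_trivial_factor u A B : 0 \notin u ->
  {in u, forall x, (x \notin A) && (x \notin B)} ->
  star_trivial (A ++ u ++ B) -> star_trivial u.
Proof.
move=> u0 uAB /star_trivialP wP.
have fixu y : y != 0 -> star_act u y = y.
  move=> y0; have [yu|] := boolP (y \in u); last exact: star_act_out.
  have /andP[yA yB] := uAB y yu; have := wP y.
  rewrite !star_act_cat (star_act_out y0 yB) -[in RHS](star_act_out y0 yA).
  exact: star_act_inj.
apply/star_trivialP => y; have [->|/fixu//] := eqVneq y 0.
(* If [0] were moved, its image would be nonzero, hence fixed by [u], and injectivity would give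
   back [0]. *)
by apply/eqP; apply: contraT => /[dup] /fixu /star_act_inj ->.
Qed.

(** The second displayed [a] is the earliest letter of [w] that repeats a previous one. *)
Lemma not_uniq_split (T : eqType) (w : seq T) : ~~ uniq w ->
  exists A a u B, w = A ++ a :: u ++ a :: B /\ uniq (A ++ a :: u).
Proof.
elim/last_ind: w => //= w x IHw; rewrite rcons_uniq negb_and negbK.
have [wU|/IHw[A [a [u [B [-> U]]]] _]] := boolP (uniq w); last first.
  by exists A, a, u, (rcons B x); rewrite -!cats1 -!catA /= -catA.
rewrite orbF => xw; move: wU; case/splitPr: xw => A u U.
by exists A, x, u, [::]; rewrite -cats1 -catA.
Qed.

(** * Words in which every letter occurs exactly twice *)

Definition paired_letters (w : seq nat) : bool :=
  all (fun x => count_mem x w == 2) w.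

Lemma paired_lettersP w x : paired_letters w -> x \in w -> count_mem x w = 2.
Proof. by move=> /allP H /H /eqP. Qed.

Lemma paired_cancel A a B : paired_letters (A ++ a :: a :: B) ->
  [/\ a \notin A, a \notin B & paired_letters (A ++ B)].
Proof.
move=> P; have := paired_lettersP (x := a) P.
rewrite mem_cat in_cons eqxx orbT count_cat /= eqxx => /(_ isT)/eqP.
rewrite !add1n !addnS !eqSS addn_eq0 => /andP[/eqP aA /eqP aB].
have aA' : a \notin A by apply/count_memPn.
have aB' : a \notin B by apply/count_memPn.
split=> //; apply/allP => x; rewrite mem_cat => xAB.
have xa : a == x = false.
  by apply: contraTF xAB => /eqP<-; rewrite negb_or aA' aB'.
have := paired_lettersP (x := x) P; rewrite mem_cat !inE !count_cat /= xa.
by move=> ->//; case/orP: xAB => ->; rewrite ?orbT.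
Qed.

(** Take the earliest repetition, [A ++ a :: u ++ a :: B], and follow [a] through the product. The
    right [a] sends it to [0]; were [u] nonempty with last letter [b], that letter would send [0] to
    [b], which the rest of [u] and the left [a] fix. Then [A] would send both [b] and [a] to [a]. *)
Lemma paired_adjacent w : w != [::] -> 0 \notin w -> paired_letters w ->
  star_trivial w -> exists A a B, w = A ++ a :: a :: B.
Proof.
move=> wn w0 wP /star_trivialP wT.
have /not_uniq_split[A [a [u [B [wE U]]]]] : ~~ uniq w.
  case: w wn wP {w0 wT} => // x w _ wP; apply/negP => /count_uniq_mem-/(_ x).
  by rewrite (paired_lettersP wP (mem_head _ _)) mem_head.
have aw : a \in w by rewrite wE mem_cat mem_head orbT.
have a0 : a != 0 by apply: contraNneq w0 => <-.
move: U; rewrite cat_uniq /= negb_or.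
move=> /and4P[_ /andP[aA /hasPn uA] au uU].
have aB : a \notin B.
  apply/count_memPn; have := paired_lettersP wP aw.
  rewrite wE count_cat /= eqxx count_cat /= eqxx.
  by rewrite (count_memPn aA) (count_memPn au) !add0n !add1n => -[].
exists A, a, B; rewrite wE; case/lastP: u => // u b in wE au uA uU *.
have bw : b \in w by rewrite wE mem_cat inE mem_cat mem_rcons mem_head !orbT.
have b0 : b != 0 by apply: contraNneq w0 => <-.
move: au uU; rewrite mem_rcons inE negb_or rcons_uniq.
move=> /andP[ab au] /andP[bu uU].
have := wT a; rewrite wE star_act_cat /= star_act_cat /= (star_act_out a0 aB).
rewrite {2}/star_transp (negbTE a0) eqxx star_act_rcons {2}/star_transp /=.
rewrite (star_act_out b0 bu) -[RHS](star_act_out a0 aA) => /star_act_inj.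
rewrite /star_transp (negbTE b0) eq_sym (negbTE ab) => ba.
by rewrite ba eqxx in ab.
Qed.

(** Imposed on consecutive factors only, through [sorted]: factors further apart may share letters,
    as two runs of the same colour may. *)
Definition disjoint_letters (u v : seq nat) : bool := ~~ has (mem u) v.

Lemma sorted_shrink us1 us2 u u' : {subset u' <= u} ->
  sorted disjoint_letters (us1 ++ u :: us2) ->
  sorted disjoint_letters (us1 ++ u' :: us2).
Proof.
move=> uu'.
have shr x : disjoint_letters x u -> disjoint_letters x u'.
  by move=> /hasPn H; apply/hasPn => y /uu'; exact: H.
have shl x : disjoint_letters u x -> disjoint_letters u' x.
  by move=> /hasPn H; apply/hasPn => y /H; apply: contra => /uu'.
case: us1 => [|x us1] /=; first by case: us2 => //= v us2 /andP[/shl -> ->].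
rewrite !cat_path /= => /and3P[-> /shr -> /=].
by case: us2 => //= v us2 /andP[/shl -> ->].
Qed.

(* Nonempty neighbours have no letter in common, so two consecutive equal
   letters of the flattened word lie in the same factor. *)
Lemma flatten_adjacent us A a B : sorted disjoint_letters us ->
  all (fun u => u != [::]) us -> flatten us = A ++ a :: a :: B ->
  exists us1 us2 u1 u2, us = us1 ++ (u1 ++ a :: a :: u2) :: us2 /\
    A ++ B = flatten (us1 ++ (u1 ++ u2) :: us2).
Proof.
elim: us A => [|u us IHus] A /=; first by case: A.
move=> us_s /andP[un usn] E.
elim: u A un E us_s IHus => // x u IHu [|y A] _ /= [<-].
  case: u {IHu} => [|z u] /=.
    case: us usn => // -[|z v] us //= _ [-> _] /andP[/hasP[]].
    by exists x; [exact: mem_head | exact: mem_head].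
  move=> [-> <-] _ _; exists [::], us, [::], u; by [].
case: u IHu => [_|z u IHu] E us_s IHus.
  have [us1 [us2 [u1 [u2 [-> ->]]]]] := IHus A (path_sorted us_s) usn E.
  by exists ([:: x] :: us1), us2, u1, u2.
have [|us1 [us2 [u1 [u2 [E1 E2]]]]] := IHu A isT E _ IHus.
  case: us us_s {E IHu IHus usn} => //= v us /andP[d ->]; rewrite andbT.
  apply/hasPn => t tv; have /hasPn/(_ t tv) := d.
  by apply: contra => /=; rewrite [t \in x :: _]in_cons => ->; rewrite orbT.
case: us1 E1 E2 => [|v us1] /= [-> ->] ->.
  by exists [::], us2, (x :: u1), u2.
by exists ((x :: v) :: us1), us2, u1, u2.
Qed.

(** Induction on the length: as long as no factor is empty, two adjacent equal letters exist, lie in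
    one factor and can be cancelled. An empty factor is a witness, and restoring a cancelled pair
    adds two to one count, so no count becomes [1]. *)
Lemma paired_closed_factor us : us != [::] -> sorted disjoint_letters us ->
  0 \notin flatten us -> paired_letters (flatten us) ->
  star_trivial (flatten us) ->
  exists2 u, u \in us & forall x, count_mem x u != 1.
Proof.
have [m] := ubnP (size (flatten us)); elim: m us => // m IHm us le_m usn.
move=> us_s us0 usP usT.
have [usn0|] := boolP (all (fun u => u != [::]) us); last first.
  by case/allPn => u uus /negPn/eqP u0; exists u => // x; rewrite u0.
have wn : flatten us != [::].
  by case: us usn usn0 {le_m us_s us0 usP usT} => // -[].
have [A [a [B wE]]] := paired_adjacent wn us0 usP usT.
have [us1 [us2 [u1 [u2 [usE ABE]]]]] := flatten_adjacent us_s usn0 wE.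
rewrite wE in us0 usP usT le_m; have [aA aB ABP] := paired_cancel usP.
have [||||||u uP uC] := IHm (us1 ++ (u1 ++ u2) :: us2).
- rewrite -ABE; move: le_m; rewrite !size_cat /= !addnS ltnS.
  exact: leq_trans.
- by case: (us1).
- rewrite usE in us_s; apply: sorted_shrink us_s => x.
  by rewrite !mem_cat !inE => /orP[] ->; rewrite ?orbT.
- rewrite -ABE; apply: contra us0; rewrite !mem_cat !inE.
  by case/orP => ->; rewrite ?orbT.
- by rewrite -ABE.
- rewrite -ABE; apply/star_trivialP => y.
  by rewrite -[RHS](star_trivialP _ usT) !star_act_cat /= star_transpK.
rewrite mem_cat inE in uP; case/or3P: uP => [uP|/eqP uE|uP].
- by exists u => //; rewrite usE mem_cat uP.
- exists (u1 ++ a :: a :: u2); first by rewrite usE mem_cat mem_head orbT.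
  move=> x; have := uC x; rewrite uE !count_cat /=.
  by case: (a == x) => /= *; rewrite ?add1n ?addnS.
- by exists u => //; rewrite usE mem_cat inE uP !orbT.
Qed.

(** A factor in which no letter occurs once holds both copies of each of its letters, so it shares
    none with the rest and would itself be trivial. *)
Lemma paired_split_nontrivial us : us != [::] -> sorted disjoint_letters us ->
  0 \notin flatten us -> paired_letters (flatten us) ->
  all (fun u => ~~ star_trivial u) us -> ~~ star_trivial (flatten us).
Proof.
move=> usn us_s us0 usP usN; apply/negP => usT.
have [u uus uC] := paired_closed_factor usn us_s us0 usP usT.
have := allP usN u uus; move: us0 usP usT.
case/splitPr: uus => us1 us2; rewrite flatten_cat /= => w0 wP wT /negP[].
move: wT; apply: star_trivial_factor => [|x xu].
  by apply: contra w0 => u0; rewrite !mem_cat u0 orbT.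
have xw : x \in flatten us1 ++ u ++ flatten us2 by rewrite !mem_cat xu orbT.
have := paired_lettersP wP xw; rewrite !count_cat.
have := uC x; have : 0 < count_mem x u by rewrite -has_count has_pred1.
case: (count_mem x u) => [|[|c]] //= _ _.
rewrite addnCA !addSn => -[] /eqP; rewrite !addn_eq0.
by move=> /and3P[_ /eqP/count_memPn-> /eqP/count_memPn->].
Qed.

(** The length is the sum of the counts of the distinct letters, and each count is at least [2]. *)
Lemma leqif_undup_count (T : eqType) (w : seq T) :
  (forall x, count_mem x w != 1) ->
  (size (undup w)).*2 <= size w ?= iff all (fun x => count_mem x w == 2) w.
Proof.
move=> wC.
have -> : size w = \sum_(x <- undup w) count_mem x w.
  under eq_bigr do rewrite -sum1_count big_mkcond.
  rewrite exchange_big /= -sum1_size big_seq [RHS]big_seq.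
  apply: eq_bigr => y yw; rewrite -big_mkcond /= sum1_count.
  under eq_count do rewrite eq_sym.
  by rewrite count_uniq_mem ?undup_uniq // mem_undup yw.
have : {subset undup w <= w} by move=> x; rewrite mem_undup.
have -> : all (fun x => count_mem x w == 2) w
  = all (fun x => count_mem x w == 2) (undup w).
  by apply: eq_all_r => x; rewrite mem_undup.
elim: (undup w) => [|x s IHs] sw; first by rewrite big_nil.
rewrite big_cons /= doubleS -add2n; apply: leqif_add; last first.
  by apply: IHs => y ys; rewrite sw // inE ys orbT.
split; last exact: eq_sym.
have : 0 < count_mem x w by rewrite -has_count has_pred1 sw ?mem_head.
by have := wC x; case: (count_mem x w) => [|[]].
Qed.

Local Open Scope ring_scope.

(** * Counting words by pattern *)

Section Words.
Variables (I : eqType) (L : I -> seq nat).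

Definition words (c : seq I) : seq (seq nat) :=
  foldr (fun i W => [seq x :: w | x <- L i, w <- W]) [:: [::]] c.

Lemma big_words_cat (V : nmodType) c d (F : seq nat -> V) :
  \sum_(w <- words (c ++ d)) F w =
  \sum_(u <- words c) \sum_(v <- words d) F (u ++ v).
Proof.
elim: c F => [|i c IHc] F /=; first by rewrite big_seq1.
rewrite !big_allpairs_dep; apply: eq_bigr => x _; exact: IHc.
Qed.

Lemma big_words_rcons (V : nmodType) c i (F : seq nat -> V) :
  \sum_(w <- words (rcons c i)) F w =
  \sum_(u <- words c) \sum_(x <- L i) F (rcons u x).
Proof.
rewrite -cats1 big_words_cat; apply: eq_bigr => u _.
rewrite /= flatten_map1 big_map.
by under eq_bigr do rewrite cats1.
Qed.

Lemma mem_words c w :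
  (w \in words c) = all2 (fun i x => x \in L i) c w.
Proof.
elim: c w => [|i c IHc] [|x w] /=.
- by rewrite inE.
- by rewrite inE.
- by apply/allpairsP => -[] /= [y u] [].
rewrite -IHc; apply/allpairsP/andP => [[[y u]] /= [? ? [-> ->]]//|[xi wc]].
by exists (x, w).
Qed.

Lemma words_size c w : w \in words c -> size w = size c.
Proof. by rewrite mem_words all2E => /andP[/eqP]. Qed.

Lemma words_nth c w i k : w \in words c -> (k < size w)%N ->
  nth 0%N w k \in L (nth i c k).
Proof.
elim: c w k => [|j c IHc] [|x w] [|k] //; rewrite mem_words //= => /andP[//].
by rewrite -mem_words => _; exact: IHc.
Qed.

End Words.

(** A canonical form of the partition of the positions by equality of letters: each block is named
    by its least position. *)
Definition pattern (w : seq nat) : seq nat := [seq index x w | x <- w].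

Definition nblocks (w : seq nat) : nat := size (undup w).

Lemma size_pattern w : size (pattern w) = size w.
Proof. exact: size_map. Qed.

Lemma pattern_rcons w x : pattern (rcons w x) = rcons (pattern w) (index x w).
Proof.
rewrite /pattern map_rcons; congr rcons.
  by apply/eq_in_map => y yw; rewrite -cats1 index_cat yw.
rewrite -cats1 index_cat /= eqxx; case: ifPn => // xw.
by rewrite memNindex ?addn0.
Qed.

Lemma nth_pattern w k : (k < size w)%N ->
  nth 0%N (pattern w) k = index (nth 0%N w k) w.
Proof. exact: nth_map. Qed.

Lemma nblocks_rcons h k : nblocks (rcons h k) = ((k \notin h) + nblocks h)%N.
Proof.
have -> : nblocks (rcons h k) = nblocks (k :: h).
  by apply/perm_size/perm_undup => x; rewrite mem_rcons.
by rewrite /nblocks /=; case: (k \in h).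
Qed.

Lemma nblocks_map f w : {in w &, injective f} ->
  nblocks (map f w) = nblocks w.
Proof.
move=> fI; rewrite /nblocks -[RHS](size_map f); apply/perm_size.
apply: uniq_perm; rewrite ?undup_uniq //.
  rewrite map_inj_in_uniq ?undup_uniq // => x y.
  by rewrite !mem_undup; exact: fI.
move=> x; rewrite mem_undup.
by apply/mapP/mapP => -[y yw ->]; exists y; rewrite ?mem_undup// -mem_undup.
Qed.

Lemma nblocks_pattern w : nblocks (pattern w) = nblocks w.
Proof. by apply: nblocks_map => x y xw yw; exact: index_inj. Qed.

Section PatternRecursion.
Variables (I : eqType) (L : I -> seq nat).
Hypothesis Luniq : forall i, uniq (L i).
Hypothesis Ldisj : forall i j x, x \in L i -> x \in L j -> i = j.

(* For a word of pattern [h] coloured by [c], whether the letter at position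
   [k] is a first occurrence and has colour [i]. *)
Definition first_of (c : seq I) (h : seq nat) (i : I) (k : nat) : bool :=
  (nth 0%N h k == k) && (nth i c k == i).

(** The only letter that can first occur at [k] is the one standing there; disjointness of the lists
    makes it belong to [L i] exactly when position [k] has colour [i]. *)
Lemma count_index c w i k : w \in words L c -> (k < size w)%N ->
  count (fun x => index x w == k) (L i) = first_of c (pattern w) i k.
Proof.
move=> wc kw; have nL := words_nth i wc kw.
rewrite /first_of nth_pattern //.
have -> : count (fun x => index x w == k) (L i) =
    ((index (nth 0%N w k) w == k) * count_mem (nth 0%N w k) (L i))%N.
  case: eqP => [E|E]; rewrite ?mul1n ?mul0n.
    apply: eq_count => x /=; apply/eqP/eqP => [xk|->//].
    by rewrite -xk nth_index // -index_mem xk.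
  apply/eqP; rewrite eqn0Ngt -has_count; apply/hasPn => x _.
  apply/eqP => xk; apply: E; rewrite -{1}xk nth_index // -index_mem xk //.
rewrite count_uniq_mem //; case: eqP => //= _; rewrite mul1n; congr nat_of_bool.
by apply/idP/eqP => [/(Ldisj nL)|<-//].
Qed.

(** A letter of [L i] either occurs in [w], and is then located by its first position, or is new,
    with index [size w]; the new ones are counted by complement. *)
Lemma sum_index (K : pzRingType) c w i (g : nat -> K) : w \in words L c ->
  \sum_(x <- L i) g (index x w) =
  \sum_(k < size w) (first_of c (pattern w) i k)%:R * g k +
  ((size (L i))%:R - \sum_(k < size w) (first_of c (pattern w) i k)%:R)
    * g (size w).
Proof.
move=> wc.
have fE (k : 'I_(size w)) : (first_of c (pattern w) i k)%:R =
    \sum_(x <- L i) (index x w == k)%:R :> K.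
  by rewrite -(count_index i wc (ltn_ord k)) -sum1_count natr_sum big_mkcond /=;
    apply: eq_bigr => x _; case: eqP.
under [X in _ = X + _]eq_bigr do rewrite fE.
under [X in _ - X]eq_bigr do rewrite fE.
rewrite -(sum1_size (L i)) natr_sum exchange_big /= -sumrB mulr_suml.
under [X in _ = X + _]eq_bigr do rewrite mulr_suml.
rewrite exchange_big -big_split /=; apply: eq_bigr => x _.
have [xw|xw] := ltnP (index x w) (size w).
  have E (f : nat -> K) : \sum_(k < size w) (index x w == k)%:R * f k
      = f (index x w).
    rewrite (bigD1 (Ordinal xw)) //= eqxx mul1r big1 ?addr0 // => k.
    by rewrite -val_eqE eq_sym => /negbTE /= ->; rewrite mul0r.
  have /= := E (fun=> 1); under eq_bigr do rewrite mulr1.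
  by move=> ->; rewrite subrr mul0r addr0 E.
have -> : index x w = size w by apply/eqP; rewrite eqn_leq index_size.
have E (k : 'I_(size w)) : (size w == k) = false by rewrite gtn_eqF.
rewrite !big1 ?subr0 ?mul1r ?add0r// => k _; rewrite E ?mul0r//.
Qed.

End PatternRecursion.

(** * Limits of sums over words with fixed colours *)

Lemma cvg_sumr (K : numFieldType) (V : normedModType K) (T : Type)
    (F : set_system T) (FF : Filter F) (J : Type) (r : seq J)
    (f : J -> T -> V) (l : J -> V) :
  (forall j, (f j @ F --> l j)%classic) ->
  ((fun x => \sum_(j <- r) f j x) @ F --> \sum_(j <- r) l j)%classic.
Proof. by move=> fl; apply: cvg_big => //; exact: add_continuous. Qed.

Section PatternLimit.
Variables (C : numFieldType) (I : eqType) (L : nat -> I -> seq nat).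
Variables (v : nat -> C) (len : I -> C).
Hypothesis Luniq : forall n i, uniq (L n i).
Hypothesis Ldisj : forall n i j x, x \in L n i -> x \in L n j -> i = j.
Hypothesis v0 : (v @ \oo --> (0 : C))%classic.
Hypothesis Llen :
  forall i, ((fun n => v n * (size (L n i))%:R) @ \oo --> len i)%classic.

(** Induction on the last letter: it is either one of boundedly many old letters, or a new one, and
    the number of new ones weighted by [v n] tends to [len i]. [Lambda] is chosen before [F]; its
    vanishing on the zero limit is what later makes centred moments tend to 0. *)
Lemma pattern_sum_cvg (c : seq I) : exists Lambda : (seq nat -> C) -> C,
  (forall l, (forall h, l h = 0) -> Lambda l = 0) /\
  forall (F : nat -> seq nat -> C) (l : seq nat -> C),
    (forall h, (F^~ h @ \oo --> l h)%classic) ->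
    ((fun n => \sum_(w <- words (L n) c)
        F n (pattern w) * v n ^+ nblocks w) @ \oo --> Lambda l)%classic.
Proof.
elim/last_ind: c => [|c i [Lambda [Lambda0 LambdaP]]].
  exists (fun l => l [::]); split=> // F l Fl /=.
  by under eq_fun do rewrite big_seq1 mulr1; exact: Fl.
pose g (l : seq nat -> C) h :=
  \sum_(k < size h) (first_of c h i k)%:R * l (rcons h k) +
  len i * l (rcons h (size h)).
(* The total weight of the one-letter extensions of a word of pattern [h]; the extra block of a new
   letter accounts for the factor [v n]. *)
pose G (F : nat -> seq nat -> C) n h :=
  \sum_(k < size h) (first_of c h i k)%:R * F n (rcons h k) +
  v n * ((size (L n i))%:R - \sum_(k < size h) (first_of c h i k)%:R)
    * F n (rcons h (size h)).
exists (fun l => Lambda (g l)); split=> [l l0|F l Fl].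
  apply: Lambda0 => h; rewrite /g l0 mulr0 big1 ?addr0 // => k _.
  by rewrite l0 mulr0.
have GP h : (G F ^~ h @ \oo --> g l h)%classic.
  apply: cvgD.
    apply: cvg_sumr => k; apply: cvgM; [exact: cvg_cst|exact: Fl].
  apply: cvgM; last exact: Fl.
  (* The number of old letters does not grow with [n], so its product with [v n] vanishes in the
     limit. *)
  under eq_fun do rewrite mulrBr.
  rewrite -[len i]subr0.
  rewrite -[X in _ - X](mul0r (\sum_(k < size h) (first_of c h i k)%:R)).
  apply: cvgB; first exact: Llen.
  apply: cvgM => //; exact: cvg_cst.
suff E n : \sum_(w <- words (L n) (rcons c i))
      F n (pattern w) * v n ^+ nblocks w =
    \sum_(w <- words (L n) c) G F n (pattern w) * v n ^+ nblocks w.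
  by under eq_fun do rewrite E; exact: LambdaP.
rewrite big_words_rcons big_seq [RHS]big_seq; apply: eq_bigr => w wc.
under eq_bigr do rewrite pattern_rcons -nblocks_pattern pattern_rcons.
rewrite (sum_index (@Luniq n) (@Ldisj n) i 
  (fun k => F n (rcons (pattern w) k) *
    v n ^+ nblocks (rcons (pattern w) k)) wc).
rewrite /G size_pattern. rewrite [RHS]mulrDl mulr_suml; congr (_ + _).
  apply: eq_bigr => k _; rewrite -mulrA.
  rewrite /first_of; case: eqP => /= kE; last by rewrite !mul0r.
  (* The position [k] is its own first occurrence, so appending [k] to the pattern creates no new
     block. *)
  have kh : (k : nat) \in pattern w.
    by rewrite -[X in X \in _]kE mem_nth // size_pattern.
  by rewrite nblocks_rcons kh add0n nblocks_pattern.
rewrite nblocks_rcons nblocks_pattern.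
have -> : size w \notin pattern w.
  by apply/mapP => -[x xw E]; move: xw; rewrite -index_mem -E ltnn.
rewrite add1n exprS; ring.
Qed.

End PatternLimit.

(** Fixing [0] protects the common point of all star transpositions, and injectivity on [0 :: w]
    keeps nonzero letters away from it. *)
Definition renaming_invariant (Q : pred (seq nat)) : Prop :=
  forall w f, f 0%N = 0%N -> {in 0%N :: w &, injective f} -> Q (map f w) = Q w.

Lemma renaming_invariant_trivial : renaming_invariant star_trivial.
Proof. by move=> w f f0 fI; exact: star_trivial_map. Qed.

Lemma renaming_invariant_uniq : renaming_invariant uniq.
Proof.
move=> w f f0 fI; rewrite map_inj_in_uniq // => x y xw yw.
by apply: fI; rewrite inE ?xw ?yw orbT.
Qed.

Lemma renaming_invariantI P Q : renaming_invariant P -> renaming_invariant Q ->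
  renaming_invariant (fun w => P w && Q w).
Proof. by move=> hP hQ w f f0 fI; rewrite hP ?hQ. Qed.

Lemma renaming_invariantN Q : renaming_invariant Q ->
  renaming_invariant (fun w => ~~ Q w).
Proof. by move=> hQ w f f0 fI; rewrite hQ. Qed.

Definition cat_pred (k : nat) (P Q : pred (seq nat)) : pred (seq nat) :=
  fun w => P (take k w) && Q (drop k w).

Lemma renaming_invariant_cat k P Q :
  renaming_invariant P -> renaming_invariant Q ->
  renaming_invariant (cat_pred k P Q).
Proof.
move=> hP hQ w f f0 fI; rewrite /cat_pred -map_take -map_drop hP ?hQ //.
- move=> x y xw yw; apply: fI; [move: xw|move: yw];
  by rewrite !inE => /orP[->//|/mem_drop->]; rewrite orbT.
- move=> x y xw yw; apply: fI; [move: xw|move: yw];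
  by rewrite !inE => /orP[->//|/mem_take->]; rewrite orbT.
Qed.

Section WordCount.
Variables (C : numFieldType) (I : eqType) (L : nat -> I -> seq nat).
Variables (q : nat -> C) (len : I -> C).
Hypothesis Luniq : forall n i, uniq (L n i).
Hypothesis Ldisj : forall n i j x, x \in L n i -> x \in L n j -> i = j.
Hypothesis Lneq0 : forall n i, 0%N \notin L n i.
Hypothesis q0 : (q @ \oo --> (0 : C))%classic.
Hypothesis Llen :
  forall i, ((fun n => q n ^+ 2 * (size (L n i))%:R) @ \oo --> len i)%classic.

Lemma words_neq0 n c w : w \in words (L n) c -> 0%N \notin w.
Proof.
rewrite mem_words; elim: c w => [|i c IHc] [|x w] //= /andP[xi /IHc].
rewrite inE negb_or => ->; rewrite andbT.
by apply: contraNneq (Lneq0 n i) => ->.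
Qed.

(** With [N = size c], a word with [b] blocks has weight [q n ^+ N], that is, [q n ^+ (N - 2 b)]
    times [(q n ^+ 2) ^+ b], so patterns with [2 b < N] vanish in the limit. [P] bounds the number
    of blocks of the counted words; a strict bound leaves nothing. *)
Lemma word_count_cvg (c : seq I) (Q : pred (seq nat)) (P : pred nat) :
  renaming_invariant Q ->
  (forall n w, w \in words (L n) c -> Q w -> P (nblocks w)) ->
  (forall b, P b -> b.*2 <= size c)%N ->
  exists l : C, ((forall b, P b -> b.*2 < size c)%N -> l = 0) /\
    ((fun n => q n ^+ size c * \sum_(w <- words (L n) c) (Q w)%:R) @ \oo
      --> l)%classic.
Proof.
move=> Qinv QP Ple.
have v0 : ((fun n => q n ^+ 2) @ \oo --> (0 : C))%classic.
  by under eq_fun do rewrite expr2; rewrite -(mulr0 0); apply: cvgM.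
have [Lam [Lam0 LamP]] := pattern_sum_cvg Luniq Ldisj v0 Llen c.
have qX k : ((fun n => q n ^+ k) @ \oo --> ((k == 0%N)%:R : C))%classic.
  elim: k => [|k IHk]; first by under eq_fun do rewrite expr0; exact: cvg_cst.
  have -> : (k.+1 == 0%N)%:R = 0 * (k == 0%N)%:R :> C by rewrite mul0r.
  by under eq_fun do rewrite exprS; apply: cvgM.
(* Truncated subtraction does no harm: [F] and [l] vanish unless [P (nblocks h)] holds, which bounds
   the subtracted term by [size c]. *)
pose e h := (size c - (nblocks h).*2)%N.
(* Pattern indices start at [0], while the words avoid [0]; hence the shift by [S] before [Q] is
   tested. *)
pose l h : C := (Q (map S h) && P (nblocks h))%:R * (e h == 0%N)%:R.
pose F n h := (Q (map S h) && P (nblocks h))%:R * q n ^+ e h.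
have Fl h : (F^~ h @ \oo --> l h)%classic.
  by apply: cvgM; [exact: cvg_cst|exact: qX].
exists (Lam l); split=> [Plt|].
  apply: Lam0 => h; rewrite /l /e; case: (boolP (P _)) => [/Plt|_].
    by rewrite -subn_gt0 => /gtn_eqF ->; rewrite mulr0.
  by rewrite andbF mul0r.
suff E n : q n ^+ size c * \sum_(w <- words (L n) c) (Q w)%:R =
    \sum_(w <- words (L n) c) F n (pattern w) * (q n ^+ 2) ^+ nblocks w.
  by under eq_fun do rewrite E; exact: LamP.
rewrite mulr_sumr big_seq [RHS]big_seq; apply: eq_bigr => w wc.
have w0 := words_neq0 wc.
(* The renaming is the index in [0 :: w], which fixes [0] and sends a letter to one more than its
   index in [w]. *)
have QE : Q (map S (pattern w)) = Q w.
  rewrite -map_comp -[RHS](Qinv _ (index^~ (0%N :: w))) //; last first.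
    by move=> x y xw yw; exact: index_inj.
  congr Q; apply/eq_in_map => x xw /=.
  by case: eqP => // x0; rewrite x0 xw in w0.
rewrite /F /e nblocks_pattern QE.
case: (boolP (Q w)) => [/(QP _ _ wc) Pw|_]; last by rewrite mulr0 !mul0r.
by rewrite Pw mul1r mulr1 -exprM -exprD mul2n subnK ?Ple.
Qed.

End WordCount.

(** * Sums of words in the group algebra *)

Definition star_perm (w : seq nat) : fsperm :=
  foldr (fun a g => (cycle_perm [:: 0%N; a] * g)%g) 1%g w.

Lemma fspermME (g h : fsperm) x : (g * h)%g x = g (h x).
Proof. exact: fscompE. Qed.

Lemma fsperm1E x : (1%g : fsperm) x = x.
Proof. exact: fsfun0E. Qed.

Lemma cycle_perm2 a : cycle_perm [:: 0%N; a] =1 star_transp a.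
Proof.
move=> y; rewrite /= cycle_funE /star_transp.
have [->|a0] := eqVneq a 0%N; first by case: y.
by rewrite /= inE eq_sym (negbTE a0).
Qed.

Lemma star_permE w : star_perm w =1 star_act w.
Proof.
elim: w => [|a w IHw] y; first exact: fsperm1E.
by rewrite [star_perm _]/= fspermME IHw cycle_perm2.
Qed.

Lemma star_perm_cat u v : star_perm (u ++ v) = (star_perm u * star_perm v)%g.
Proof. by elim: u => [|a u IHu] /=; rewrite ?mul1g // IHu mulgA. Qed.

Lemma star_perm_eq1 w : (star_perm w == 1%g) = star_trivial w.
Proof.
apply/eqP/star_trivialP => [wE y|wE]; first by rewrite -star_permE wE fsperm1E.
by apply/fspermP => y; rewrite star_permE wE fsperm1E.
Qed.

(** [(0 a1 ... ar) = (0 ar) ... (0 a1)]: the factor of [a1] acts first, hence the reversal. *)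
Lemma cycle_star_perm s : uniq (0%N :: s) ->
  cycle_perm (0%N :: s) = star_perm (rev s).
Proof.
move=> sU; apply/fspermP => y; rewrite star_permE cycle_permE //.
elim: s y sU => [|a s IHs] y; first by case: y.
rewrite cons_uniq inE negb_or eq_sym => /andP[/andP[a0 s0]].
rewrite cons_uniq => /andP[as_ sU].
rewrite rev_cons star_act_rcons -IHs ?cons_uniq ?s0 // /star_transp.
have next_atN x (z t : nat) p : x \notin t :: p -> next_at x z t p = x.
  elim: p t => [|u p IHp] t /=; rewrite in_cons negb_or => /andP[/negbTE->] //.
  exact: IHp.
case: (eqVneq y 0%N) => [->|y0] /=; last first.
  by case: s {IHs s0 as_ sU next_atN} => [|b s] /=;
    case: (eqVneq y a); rewrite ?eqxx ?(negbTE y0).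
by rewrite next_atN // inE negb_or a0.
Qed.

Definition centred_power (C : numClosedFieldType) (A : ncProbSpaceType C)
    (I : Type) (x : I -> A) (u : I * nat) : A :=
  x u.1 ^+ u.2 - (nctrace (x u.1 ^+ u.2))%:A.

Section WordSums.
Variables (C : numClosedFieldType) (I : eqType) (L : I -> seq nat).
Local Notation A := (galg C fsperm).

Definition word_sum (c : seq I) (Q : pred (seq nat)) : A :=
  \sum_(w <- words L c | Q w) << star_perm w >>.

Lemma word_sumM c d P Q :
  word_sum c P * word_sum d Q = word_sum (c ++ d) (cat_pred (size c) P Q).
Proof.
rewrite /word_sum [in RHS]big_mkcond big_words_cat /= mulr_suml.
rewrite big_mkcond big_seq [RHS]big_seq; apply: eq_bigr => u uc.
rewrite -(words_size uc) /cat_pred.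
under [RHS]eq_bigr do rewrite take_size_cat // drop_size_cat //.
case: ifP => Pu; last by rewrite big1.
rewrite mulr_sumr big_mkcond; apply: eq_bigr => v _.
case: ifP => Qv //=.
by rewrite [LHS]galg_mulUU mul1r star_perm_cat.
Qed.

Lemma nctrace_star_perm w :
  nctrace (<< star_perm w >> : A) = (star_trivial w)%:R.
Proof.
by rewrite -star_perm_eq1 [LHS]mcoeffU.
Qed.

Lemma nctrace_word_sum c Q : nctrace (word_sum c Q) =
  \sum_(w <- words L c) (Q w && star_trivial w)%:R.
Proof.
rewrite /word_sum raddf_sum big_mkcond; apply: eq_bigr => w _.
by case: ifP => //= _; rewrite nctrace_star_perm.
Qed.

(* The trace is the coefficient of the identity, so centring just removes the
   words whose permutation is the identity. *)
Lemma word_sum_centred c Q :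
  word_sum c Q - (nctrace (word_sum c Q))%:A =
  word_sum c (fun w => Q w && ~~ star_trivial w).
Proof.
rewrite nctrace_word_sum /word_sum scaler_suml -sumrN.
rewrite big_mkcond [RHS]big_mkcond -big_split /=.
apply: eq_bigr => w _; case: (Q w); rewrite ?scale0r ?subr0 //=.
case: (boolP (star_trivial w)) => [|_]; last by rewrite scale0r subr0.
by rewrite -star_perm_eq1 => /eqP ->; rewrite scale1r subrr.
Qed.

Variables (r : I -> nat) (q : C).

(** For [q = n^(-1/2)] this is [M_i(n)], each cycle being spelled as a duplicate-free word of star
    transpositions. *)
Definition cycle_elt (i : I) : A :=
  q ^+ r i *: word_sum (nseq (r i) i) uniq.

Lemma mcoeff_cycle_elt i g : (cycle_elt i)@_g =
  q ^+ r i *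
  \sum_(w <- words L (nseq (r i) i) | uniq w) (star_perm w == g)%:R.
Proof.
rewrite mcoeffZ raddf_sum /=; congr (_ * _); apply: eq_bigr => w _.
by rewrite mcoeffU.
Qed.

Definition word_colours (s : seq I) : seq I :=
  flatten [seq nseq (r i) i | i <- s].

(** Distinctness is imposed within each cycle; letters of different cycles may coincide. *)
Fixpoint blocks_uniq (s : seq I) : pred (seq nat) :=
  if s is i :: s' then cat_pred (r i) uniq (blocks_uniq s') else predT.

Lemma cycle_elt_prod s : \prod_(i <- s) cycle_elt i =
  q ^+ size (word_colours s) *: word_sum (word_colours s) (blocks_uniq s).
Proof.
elim: s => [|i s IHs]; first by rewrite big_nil scale1r /word_sum big_seq1.
rewrite big_cons IHs -scalerAl -scalerAr scalerA -exprD word_sumM.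
rewrite -[word_colours (i :: s)]/(_ ++ word_colours s) size_cat !size_nseq.
by congr (_ *: _).
Qed.

Lemma blocks_uniq_invariant s : renaming_invariant (blocks_uniq s).
Proof.
elim: s => [|i s IHs] //=; apply: renaming_invariant_cat => //.
exact: renaming_invariant_uniq.
Qed.

(** A pair [(i, m)] stands for a run, the [m]-th power of [cycle_elt i]. *)
Definition run_colours (s : seq (I * nat)) : seq I :=
  flatten [seq word_colours (nseq u.2 u.1) | u <- s].

Fixpoint runs_nontrivial (s : seq (I * nat)) : pred (seq nat) :=
  if s is u :: s' then
    cat_pred (size (word_colours (nseq u.2 u.1)))
      (fun w => blocks_uniq (nseq u.2 u.1) w && ~~ star_trivial w)
      (runs_nontrivial s')
  else predT.

Lemma runs_nontrivial_invariant s : renaming_invariant (runs_nontrivial s).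
Proof.
elim: s => [|i s IHs] //=; apply: renaming_invariant_cat => //.
apply: renaming_invariantI; first exact: blocks_uniq_invariant.
exact/renaming_invariantN/renaming_invariant_trivial.
Qed.

Lemma centred_cycle_eltE u : centred_power cycle_elt u =
  q ^+ size (word_colours (nseq u.2 u.1)) *:
  word_sum (word_colours (nseq u.2 u.1))
    (fun w => blocks_uniq (nseq u.2 u.1) w && ~~ star_trivial w).
Proof.
rewrite /centred_power -word_sum_centred scalerBr scalerA -linearZ.
rewrite -cycle_elt_prod.
by rewrite big_nseq iter_mulr_1.
Qed.

Lemma centred_cycle_elt_prod s :
  \prod_(u <- s) centred_power cycle_elt u =
  q ^+ size (run_colours s) *: word_sum (run_colours s) (runs_nontrivial s).
Proof.
elim: s => [|u s IHs]; first by rewrite big_nil scale1r /word_sum big_seq1.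
rewrite big_cons IHs centred_cycle_eltE -scalerAl -scalerAr scalerA -exprD.
rewrite word_sumM -[run_colours (u :: s)]/(_ ++ run_colours s) size_cat.
by congr (_ *: _).
Qed.

Lemma words_const i c w : all (pred1 i) c -> w \in words L c ->
  all (mem (L i)) w.
Proof.
rewrite mem_words; elim: c w => [|j c IHc] [|x w] //= /andP[/eqP-> ic].
by move=> /andP[-> /(IHc _ ic)].
Qed.

Lemma words_split c d w : w \in words L (c ++ d) ->
  take (size c) w \in words L c /\ drop (size c) w \in words L d.
Proof.
rewrite !mem_words; elim: c w => [|i c IHc] [|x w] //=.
by move=> /andP[-> /IHc].
Qed.

(** The word is cut at the ends of the runs. Each factor keeps its colour, from which the
    disjointness of neighbours will follow. *)
Lemma runs_nontrivial_split s w : w \in words L (run_colours s) ->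
  runs_nontrivial s w -> exists2 us, w = flatten us &
    all2 (fun i u => ~~ star_trivial u && all (mem (L i)) u) (map fst s) us.
Proof.
elim: s w => [|[i m] s IHs] w.
  by rewrite mem_words; case: w => // _ _; exists [::].
rewrite /run_colours /= -/(run_colours s) /cat_pred.
set k := size _ => wc /andP[/andP[_ uN] vN].
have [uc vc] : take k w \in words L (word_colours (nseq m i)) /\
    drop k w \in words L (run_colours s).
  exact: words_split.
have [us vE usP] := IHs _ vc vN.
exists (take k w :: us); first by rewrite /= -vE cat_take_drop.
rewrite /= usP uN andbT /=; apply: words_const uc.
apply/allP => j /flattenP[t /mapP[y]].
by rewrite !mem_nseq => /andP[_ /eqP->] ->; rewrite mem_nseq => /andP[_].
Qed.

End WordSums.

(** * Limits of moments and of centred alternating products *)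

Section CycleEltLimit.
Variables (C : numClosedFieldType) (I : eqType) (L : nat -> I -> seq nat).
Variables (r : I -> nat) (q : nat -> C) (len : I -> C).
Hypothesis Luniq : forall n i, uniq (L n i).
Hypothesis Ldisj : forall n i j x, x \in L n i -> x \in L n j -> i = j.
Hypothesis Lneq0 : forall n i, 0%N \notin L n i.
Hypothesis q0 : (q @ \oo --> (0 : C))%classic.
Hypothesis Llen :
  forall i, ((fun n => q n ^+ 2 * (size (L n i))%:R) @ \oo --> len i)%classic.
Local Notation M n i := (cycle_elt (L n) r (q n) i).

Lemma trivial_nblocks n c w : w \in words (L n) c -> star_trivial w ->
  ((nblocks w).*2 <= size c ?= iff paired_letters w)%N.
Proof.
move=> wc wT; rewrite -(words_size wc); apply: leqif_undup_count => x.
exact: star_trivial_count (words_neq0 Lneq0 wc) wT.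
Qed.

Lemma cycle_elt_moment_cvg (s : seq I) : exists l : C,
  ((fun n => nctrace (\prod_(i <- s) M n i)) @ \oo --> l)%classic.
Proof.
have [|||l [_ lP]] := @word_count_cvg C I L q len Luniq Ldisj Lneq0 q0 Llen
  (word_colours r s) (fun w => blocks_uniq r s w && star_trivial w)
  (fun b => (b.*2 <= size (word_colours r s))%N).
- apply: renaming_invariantI; first exact: blocks_uniq_invariant.
  exact: renaming_invariant_trivial.
- by move=> n w wc /andP[_ /(trivial_nblocks wc)[]].
- by [].
exists l; apply: cvg_trans lP; apply: near_eq_cvg; apply: nearW => n /=.
by rewrite cycle_elt_prod linearZ /= nctrace_word_sum.
Qed.

(** The bound on the blocks is strict here: equality would make the word paired, while its runs are
    nontrivial and neighbouring runs have disjoint letters. *)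
Lemma cycle_elt_free (s : seq (I * nat)) : s != [::] ->
  sorted (fun u v : I * nat => u.1 != v.1) s ->
  ((fun n => nctrace (\prod_(u <- s)
      centred_power (cycle_elt (L n) r (q n)) u)) @ \oo --> (0 : C))%classic.
Proof.
move=> sn ss.
have [|||l [l0 lP]] := @word_count_cvg C I L q len Luniq Ldisj Lneq0 q0 Llen
  (run_colours r s) (fun w => runs_nontrivial r s w && star_trivial w)
  (fun b => (b.*2 < size (run_colours r s))%N).
- apply: renaming_invariantI; first exact: runs_nontrivial_invariant.
  exact: renaming_invariant_trivial.
- move=> n w wc /andP[wN wT]; rewrite (ltn_leqif (trivial_nblocks wc wT)).
  apply/negP => wP.
  have [us wE usP] := runs_nontrivial_split wc wN.
  have w0 := words_neq0 Lneq0 wc.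
  move: wT; apply/negP; rewrite wE in wP w0 *.
  have {sn} usn : us != [::] by case: (us) usP sn; case: (s).
  apply: paired_split_nontrivial => //; last first.
    elim: (us) s usP {ss usn wE wN wc wP w0} => [|u us' IHus] [|v s'] //=.
    by move=> /andP[/andP[-> _] /IHus].
  (* Neighbouring runs have different colours, and the lists of different colours are disjoint. *)
  have {ss}: sorted (fun i j => i != j) (map fst s) by rewrite sorted_map.
  case: (us) usP {usn wE wN wc wP w0} => // u us'.
  case: (s) => //= v s' /andP[/andP[_ uL]].
  elim: us' s' u v uL => [|u2 us2 IHus] [|v2 s2] u v uL //=.
  move=> /andP[/andP[_ u2L] usP] /andP[vv2 s2P].
  rewrite (IHus _ _ _ u2L usP s2P) andbT.
  apply/hasPn => x /(allP u2L) x2; apply/negP => /(allP uL) x1.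
  by case/eqP: vv2; exact: (Ldisj x1 x2).
- by move=> b /ltnW.
have l00 : l = 0 by apply: l0.
rewrite l00 in lP.
apply: cvg_trans lP; apply: near_eq_cvg; apply: nearW => n /=.
by rewrite centred_cycle_elt_prod linearZ /= nctrace_word_sum.
Qed.

End CycleEltLimit.

(** * The limit space *)

Section FreeAlgebra.
Variables (C : numClosedFieldType) (p : nat).
Local Notation F := {malg C[{fmonom 'I_p}]}.
Implicit Types (P Q : F) (w : {fmonom 'I_p}).

Lemma nc_scalerAr (c : C) P Q : c *: (P * Q) = P * (c *: Q).
Proof.
apply/malgP => w; rewrite [RHS](mcoeffMlw _ (fsubset_refl _) (msuppZ_le c Q)).
rewrite [LHS]mcoeffZ mcoeffMl mulr_sumr.
apply: eq_bigr => u _; rewrite mulr_sumr; apply: eq_bigr => v _.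
by rewrite mcoeffZ mulrCA mulrnAr.
Qed.

(** The antilinear involution that reverses products and for which the variables are
    self-adjoint. *)
Definition ncadj P : F :=
  \sum_(w <- msupp P) << (P@_w)^* *g FMonom (rev w) >>.

Lemma ncadjE P w : (ncadj P)@_w = (P@_(FMonom (rev w)))^*.
Proof.
rewrite raddf_sum /=; under eq_bigr do rewrite mcoeffU.
have revE (u : {fmonom 'I_p}) : (FMonom (rev u) == w) = (u == FMonom (rev w)).
  rewrite !fmP /=; apply/eqP/eqP => [<-|->]; by rewrite revK.
under eq_bigr do rewrite revE.
have [Pw|Pw] := msuppP P (FMonom (rev w)).
  rewrite (big_fsetD1 (FMonom (rev w))) //= eqxx mulr1n big_seq big1 ?addr0 //.
  by move=> u; rewrite !inE => /andP[/negbTE-> _].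
rewrite rmorph0 big_seq big1 // => u uP.
by case: eqP => // uE; rewrite -uE uP in Pw.
Qed.

Lemma ncadjK : involutive ncadj.
Proof.
move=> P; apply/malgP => w; rewrite !ncadjE conjCK /= revK.
by congr (_@_ _); apply: fmK.
Qed.

Lemma ncadj_antilinear (c : C) P Q :
  ncadj (c *: P + Q) = c^* *: ncadj P + ncadj Q.
Proof.
apply/malgP => w.
rewrite [LHS]ncadjE [RHS]mcoeffD [in RHS]mcoeffZ.
rewrite [X in _ = _ * X + _]ncadjE [X in _ = _ + X]ncadjE.
by rewrite mcoeffD mcoeffZ rmorphD rmorphM.
Qed.

Lemma ncadj_sum (J : Type) (r : seq J) (G : J -> F) :
  ncadj (\sum_(i <- r) G i) = \sum_(i <- r) ncadj (G i).
Proof.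
apply: big_morph => [x y|].
  by have := ncadj_antilinear 1 x y; rewrite rmorph1 !scale1r.
by rewrite /ncadj msupp0 big_seq_fset0.
Qed.

Lemma ncadjU c w : ncadj << c *g w >> = << c^* *g FMonom (rev w) >>.
Proof.
apply/malgP => u; rewrite ncadjE !mcoeffU rmorphMn /=.
congr (_ *+ nat_of_bool _).
by rewrite !fmP /=; apply/eqP/eqP => [->|<-]; rewrite revK.
Qed.

Lemma ncadjM P Q : ncadj (P * Q) = ncadj Q * ncadj P.
Proof.
rewrite malgME ncadj_sum mulr_sumr; apply: eq_bigr => u _.
rewrite ncadj_sum mulr_suml; apply: eq_bigr => v _.
rewrite ncadjU [RHS]fgmulUU rmorphM mulrC; congr << _ *g _ >>.
by apply/eqP; rewrite fmP /= !fmM /= rev_cat.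
Qed.

Section Evaluation.
Variables (A : ncProbSpaceType C) (x : 'I_p -> A).

Let word (w : {fmonom 'I_p}) : A := \prod_(i <- w) x i.

Lemma ncevalE P : nceval x P = mmap (in_alg A) word P.
Proof. by []. Qed.

Lemma ncevalD : {morph nceval x : P Q / P + Q}.
Proof. by move=> P Q; rewrite !ncevalE mmapD. Qed.

Lemma nceval_sum (J : Type) (r : seq J) (G : J -> F) :
  nceval x (\sum_(i <- r) G i) = \sum_(i <- r) nceval x (G i).
Proof. by rewrite ncevalE raddf_sum. Qed.

Lemma ncevalU c w : nceval x << c *g w >> = c *: \prod_(i <- w) x i.
Proof. by rewrite ncevalE mmapU mulr_algl. Qed.

Lemma ncevalM : {morph nceval x : P Q / P * Q}.
Proof.
move=> P Q; rewrite malgME nceval_sum mulr_suml; apply: eq_bigr => u _.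
rewrite nceval_sum mulr_sumr; apply: eq_bigr => v _.
rewrite ncevalU !mulr_algl fmM big_cat /=.
by rewrite -scalerAl -scalerAr scalerA.
Qed.

Lemma ncevalZ c P : nceval x (c *: P) = c *: nceval x P.
Proof.
by rewrite -mul_malgC ncevalM ncevalU fm1 big_nil mulr_algl.
Qed.

Lemma nceval1 : nceval x 1 = 1.
Proof. by rewrite ncevalU fm1 big_nil scale1r. Qed.

Lemma nceval_var i : nceval x << FMonom [:: i] >> = x i.
Proof. by rewrite ncevalU big_seq1 scale1r. Qed.

Lemma adj0 : adj (0 : A) = 0.
Proof.
have := adj_antilinear 1 (0 : A) 0; rewrite rmorph1 !scale1r addr0.
by move=> /esym/eqP; rewrite -subr_eq0 addrK => /eqP.
Qed.

Lemma adjZ (c : C) (a : A) : adj (c *: a) = c^* *: adj a.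
Proof. by have := adj_antilinear c a 0; rewrite adj0 !addr0. Qed.

Lemma adj1 : adj (1 : A) = 1.
Proof. by rewrite -[LHS]mulr1 -[X in _ * X]adjK -adjM mulr1 adjK. Qed.

Lemma adjD : {morph (@adj C A) : a b / a + b}.
Proof.
by move=> a b; have := adj_antilinear 1 a b; rewrite rmorph1 !scale1r.
Qed.

Lemma nceval_adj P : (forall i, adj (x i) = x i) ->
  nceval x (ncadj P) = adj (nceval x P).
Proof.
move=> xs; rewrite [in RHS]ncevalE /mmap (big_morph _ adjD adj0) nceval_sum.
apply: eq_bigr => w _; rewrite ncevalU mulr_algl adjZ; congr (_ *: _).
rewrite /word; elim: (fmonom_val w) => [|i s IHs].
  by rewrite !big_nil adj1.
by rewrite rev_cons -cats1 big_cat big_seq1 big_cons adjM xs IHs.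
Qed.

Lemma nctrace_ncevalE P : nctrace (nceval x P) =
  \sum_(w <- msupp P) P@_w * nctrace (\prod_(i <- w) x i).
Proof.
rewrite ncevalE /mmap raddf_sum; apply: eq_bigr => w _.
by rewrite mulr_algl /= linearZ.
Qed.

End Evaluation.

End FreeAlgebra.

Lemma cvg_seq_unique (K : numFieldType) (u : nat -> K) (a b : K) :
  (u @ \oo --> a)%classic -> (u @ \oo --> b)%classic -> a = b.
Proof. by apply: cvg_unique; exact: norm_hausdorff. Qed.

(** The order of [K] may be partial, as for complex numbers, so nonnegativity is expressed by the
    norm: each term equals its norm, hence so does the limit. *)
Lemma cvg_seq_ge0 (K : numFieldType) (u : nat -> K) (a : K) :
  (u @ \oo --> a)%classic -> (forall n, 0 <= u n) -> 0 <= a.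
Proof.
move=> ua u0; have -> : a = `|a|; last exact: normr_ge0.
apply: cvg_seq_unique (ua) _.
have -> : u = (fun n => `|u n|) by apply/funext => n; rewrite ger0_norm.
exact: cvg_norm.
Qed.

Section LimitSpace.
Variables (C : numClosedFieldType) (p : nat) (A : ncProbSpaceType C).
Variable M : nat -> 'I_p -> A.
Hypothesis M_adj : forall n i, adj (M n i) = M n i.
Hypothesis M_cvg : forall s : seq 'I_p, exists l : C,
  ((fun n => nctrace (\prod_(i <- s) M n i)) @ \oo --> l)%classic.

Definition limit_space : Type := {malg C[{fmonom 'I_p}]}.

HB.instance Definition _ := GRing.Lalgebra.on limit_space.
HB.instance Definition _ :=
  GRing.Lalgebra_isAlgebra.Build C limit_space (@nc_scalerAr C p).

Definition limit_trace (P : limit_space) : C :=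
  lim ((fun n => nctrace (nceval (M n) P)) @ \oo)%classic.

(** A polynomial is a finite combination of words, and each word has a limiting moment by
    [M_cvg]. *)
Lemma limit_traceP P :
  ((fun n => nctrace (nceval (M n) P)) @ \oo --> limit_trace P)%classic.
Proof.
apply/cvg_ex; exists (\sum_(w <- msupp P) P@_w * projT1 (cid (M_cvg w))).
under eq_fun do rewrite nctrace_ncevalE.
apply: cvg_sumr => w; apply: cvgM; first exact: cvg_cst.
exact: projT2 (cid (M_cvg w)).
Qed.

Lemma limit_trace_linear : linear_for *%R limit_trace.
Proof.
move=> c P Q; apply: (cvg_seq_unique (@limit_traceP _)).
have E n : nctrace (nceval (M n) (c *: P + Q)) =
    c * nctrace (nceval (M n) P) + nctrace (nceval (M n) Q).
  by rewrite ncevalD ncevalZ linearD linearZ.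
under eq_fun do rewrite E.
apply: cvgD; last exact: limit_traceP.
by apply: cvgM; [exact: cvg_cst|exact: limit_traceP].
Qed.

HB.instance Definition _ :=
  GRing.isLinear.Build C limit_space C *%R limit_trace limit_trace_linear.

Lemma limit_trace1 : limit_trace 1 = 1.
Proof.
apply: (cvg_seq_unique (@limit_traceP _)).
by under eq_fun do rewrite nceval1 nctrace1; exact: cvg_cst.
Qed.

Lemma limit_trace_ge0 P : 0 <= limit_trace (ncadj P * P).
Proof.
apply: (cvg_seq_ge0 (@limit_traceP _)) => n.
by rewrite ncevalM nceval_adj // nctrace_ge0.
Qed.

Lemma limit_traceC P Q : limit_trace (P * Q) = limit_trace (Q * P).
Proof.
apply: (cvg_seq_unique (@limit_traceP _)).
under eq_fun do rewrite ncevalM nctrace_tracial -ncevalM.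
exact: limit_traceP.
Qed.

HB.instance Definition _ := Algebra_isNCProbSpace.Build C limit_space
  (@ncadjK C p) (@ncadj_antilinear C p) (@ncadjM C p)
  limit_trace1 limit_trace_ge0 limit_traceC.

Definition limit_var (i : 'I_p) : limit_space := << FMonom [:: i] >>.

Lemma limit_var_adj i : adj (limit_var i) = limit_var i.
Proof. by rewrite [LHS]ncadjU rmorph1. Qed.

(** Hence the distribution of the variables is [limit_trace] itself. *)
Lemma nceval_limit_var P : nceval limit_var P = P.
Proof.
rewrite [RHS]monalgE; apply: eq_bigr => w _; rewrite mulr_algl.
have -> : \prod_(i <- w) limit_var i = << w >>.
  rewrite -[w in RHS]fmK; elim: (fmonom_val w) => [|i s IHs].
    rewrite big_nil [LHS]/(<< _ >>); congr << _ *g _ >>.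
    by apply/val_inj; rewrite /= fm1.
  rewrite big_cons IHs [LHS]fgmulUU mulr1; congr << _ *g _ >>.
  by apply/val_inj; rewrite /= fmM.
by apply/malgP => u; rewrite mcoeffZ !mcoeffU mulrnAr mulr1.
Qed.

Hypothesis M_free : forall s : seq ('I_p * nat), s != [::] ->
  sorted (fun u v : 'I_p * nat => u.1 != v.1) s ->
  ((fun n => nctrace (\prod_(u <- s) centred_power (M n) u)) @ \oo
    --> (0 : C))%classic.

Lemma nceval_powers n i (Q : {poly C}) :
  nceval (M n) (horner_alg (limit_var i) Q) =
  \sum_(k < size Q) Q`_k *: M n i ^+ k.
Proof.
have powE k : nceval (M n) (limit_var i ^+ k) = M n i ^+ k.
  elim: k => [|k IHk]; first by rewrite !expr0 nceval1.
  by rewrite !exprS ncevalM IHk nceval_var.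
rewrite -{1}[Q]coefK poly_def rmorph_sum nceval_sum; apply: eq_bigr => k _.
rewrite -mul_polyC rmorphM /= horner_algC rmorphXn /= horner_algX mulr_algl.
by rewrite ncevalZ powE.
Qed.

(** Only the existence of a limit is claimed, since it will multiply a factor tending to 0.
    Expanding the last centred power gives two products with one centred factor fewer. *)
Lemma centred_prod_cvg (s : seq ('I_p * nat)) (b : limit_space) :
  exists l : C, ((fun n =>
    nctrace (\prod_(u <- s) centred_power (M n) u * nceval (M n) b)) @ \oo
      --> l)%classic.
Proof.
elim/last_ind: s b => [|s u IHs] b.
  exists (limit_trace b); under eq_fun do rewrite big_nil mul1r.
  exact: limit_traceP.
have [l1 l1P] := IHs (limit_var u.1 ^+ u.2 * b).
have [l2 l2P] := IHs b.
exists (l1 - limit_trace (limit_var u.1 ^+ u.2) * l2).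
have powE n : nceval (M n) (limit_var u.1 ^+ u.2) = M n u.1 ^+ u.2.
  elim: (u.2) => [|k IHk]; first by rewrite !expr0 nceval1.
  by rewrite !exprS ncevalM IHk nceval_var.
have E n : nctrace (\prod_(v <- rcons s u) centred_power (M n) v *
      nceval (M n) b) =
    nctrace (\prod_(v <- s) centred_power (M n) v *
      nceval (M n) (limit_var u.1 ^+ u.2 * b)) -
    nctrace (nceval (M n) (limit_var u.1 ^+ u.2)) *
    nctrace (\prod_(v <- s) centred_power (M n) v * nceval (M n) b).
  rewrite -cats1 big_cat big_seq1 ncevalM powE /=.
  by rewrite -mulrA [centred_power (M n) u * _]mulrBl mulr_algl mulrBr -scalerAr
    linearB linearZ.
under eq_fun do rewrite E.
by apply: cvgB => //; apply: cvgM => //; exact: limit_traceP.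
Qed.

(* Centring with respect to the trace of [A] at rank [n] rather than with
   respect to the limit trace costs a scalar tending to 0. *)
Lemma mixed_prod_cvg0 (s1 : seq ('I_p * nat)) (s2 : seq ('I_p * limit_space)) :
  (size s1 + size s2 != 0)%N ->
  (forall u, u \in s2 ->
    gen_subalg (limit_var u.1) u.2 /\ limit_trace u.2 = 0) ->
  sorted (fun i j => i != j) (map fst s1 ++ map fst s2) ->
  ((fun n => nctrace (\prod_(u <- s1) centred_power (M n) u *
    nceval (M n) (\prod_(u <- s2) u.2))) @ \oo --> (0 : C))%classic.
Proof.
elim: s2 s1 => [|[i a] s2 IHs2] s1.
  rewrite addn0 cats0 => s1n _; rewrite sorted_map => s1s.
  under eq_fun do rewrite big_nil nceval1 mulr1.
  by apply: M_free => //; rewrite -size_eq0.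
move=> _ s2P ss.
have [[Q aE] a0] := s2P _ (mem_head _ _).
have {s2P} s2P u : u \in s2 ->
    gen_subalg (limit_var u.1) u.2 /\ limit_trace u.2 = 0.
  by move=> us2; apply: s2P; rewrite inE us2 orbT.
rewrite /= in aE a0; pose b := \prod_(u <- s2) u.2.
(* [a] is a combination of powers of the variable [i]; centring each power at rank [n] leaves a
   scalar, the trace of [a] at that rank. *)
have E n : nctrace (\prod_(u <- s1) centred_power (M n) u *
    nceval (M n) (\prod_(u <- (i, a) :: s2) u.2)) =
    \sum_(k < size Q) Q`_k *
      nctrace (\prod_(u <- rcons s1 (i, val k)) centred_power (M n) u *
        nceval (M n) b) +
    nctrace (nceval (M n) a) *
    nctrace (\prod_(u <- s1) centred_power (M n) u * nceval (M n) b).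
  rewrite big_cons ncevalM -/b; set z := nctrace (nceval _ a).
  have -> : nceval (M n) a =
      \sum_(k < size Q) Q`_k *: centred_power (M n) (i, val k) + z%:A.
    rewrite /z.
    rewrite aE nceval_powers linear_sum scaler_suml -big_split /=.
    apply: eq_bigr => k _; rewrite linearZ /= -scalerA -scalerDr.
    by rewrite /centred_power /= subrK.
  rewrite mulrDl mulr_algl mulrDr -scalerAr linearD linearZ.
  congr (_ + _).
  rewrite mulr_suml mulr_sumr linear_sum; apply: eq_bigr => k _.
  rewrite -scalerAl -scalerAr linearZ /= -cats1 big_cat big_seq1 mulrA.
  by [].
(* The terms of the sum over [k] tend to 0 by induction, the centred power having moved to [s1]; in
   the last term a convergent factor multiplies a trace tending to [limit_trace a], which is 0. *)
have [l lP] := centred_prod_cvg s1 b.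
have -> : (0 : C) = \sum_(k < size Q) Q`_k * 0 + limit_trace a * l.
  by rewrite a0 mul0r addr0 big1 // => k _; rewrite mulr0.
under eq_fun do rewrite E.
apply: cvgD; last by apply: cvgM => //; exact: limit_traceP.
apply: cvg_sumr => k; apply: cvgM; first exact: cvg_cst.
apply: (IHs2 (rcons s1 (i, val k))) => //; first by rewrite size_rcons.
by rewrite map_rcons cat_rcons.
Qed.

Lemma limit_var_free : free_elements limit_var.
Proof.
move=> s sn sP ss.
apply: (cvg_seq_unique (@limit_traceP _)).
have := @mixed_prod_cvg0 [::] s; rewrite add0n size_eq0 cat0s.
move=> /(_ sn sP); rewrite sorted_map => /(_ ss).
by under eq_fun do rewrite big_nil mul1r.
Qed.

Theorem asymptotically_free_of_limits : asymptotically_free M.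
Proof.
exists limit_space, limit_var; split.
- exact: limit_var_adj.
- exact: limit_var_free.
- move=> P; rewrite /ncdistr nceval_limit_var; exact: limit_traceP.
Qed.

End LimitSpace.

(** * The cycle sums *)

Lemma mem_words_nseq (I : eqType) (L : I -> seq nat) r i w :
  (w \in words L (nseq r i)) = (size w == r) && all (mem (L i)) w.
Proof.
rewrite mem_words; elim: r w => [|r IHr] [|x w] //=.
by rewrite IHr eqSS; case: (x \in L i) => //=; rewrite andbF.
Qed.

Lemma words_uniq (I : eqType) (L : I -> seq nat) c :
  (forall i, uniq (L i)) -> uniq (words L c).
Proof.
move=> LU; elim: c => //= i c IHc.
by apply: allpairs_uniq => // -[x u] [y v] _ _ [-> ->].
Qed.

(** * Integer points of the intervals *)

Section Intervals.
Variable R : realType.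

Definition interval_points (a b : R) (n : nat) : seq nat :=
  [seq k <- iota 0 (Num.truncn (n%:R * b)).+1 |
    n%:R * a < k%:R <= n%:R * b].

Lemma mem_interval_points a b n k :
  (k \in interval_points a b n) = (n%:R * a < k%:R <= n%:R * b).
Proof.
rewrite mem_filter mem_iota /= add0n ltnS; apply/andb_idr => /andP[_ kb].
by rewrite truncn_ge_nat // (le_trans _ kb) ?ler0n.
Qed.

Lemma size_interval_points a b n : 0 <= a -> a <= b ->
  size (interval_points a b n) =
  (Num.truncn (n%:R * b) - Num.truncn (n%:R * a))%N.
Proof.
move=> a0 ab; have na : 0 <= n%:R * a by rewrite mulr_ge0.
have nab : n%:R * a <= n%:R * b by rewrite ler_wpM2l.
have nb := le_trans na nab; have := le_truncn nab.
rewrite /interval_points.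
set p := Num.truncn (_ * a); set q := Num.truncn (_ * b) => pq.
rewrite size_filter -(subnKC (_ : p < q.+1)%N) ?ltnS // iotaD count_cat subSS.
rewrite (eq_in_count (a2 := pred0)) => [|k]; last first.
  by rewrite mem_iota add0n ltnS /= truncn_ge_nat // leNgt => /negbTE->.
rewrite count_pred0 add0n (eq_in_count (a2 := predT)) => [|k].
  by rewrite count_predT size_iota.
by rewrite mem_iota addSn subnKC // truncn_lt_nat // ltnS truncn_ge_nat.
Qed.

Lemma cvg_inv_nat : ((fun n => (n%:R : R)^-1) @ \oo --> (0 : R))%classic.
Proof. by rewrite -cvg_shiftS; exact: cvg_harmonic. Qed.

Lemma cvg_truncn (b : R) : 0 <= b ->
  ((fun n => n%:R^-1 * (Num.truncn (n%:R * b))%:R) @ \oo --> b)%classic.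
Proof.
move=> b0; apply: (@squeeze_cvgr _ _ _ _ (fun n => b - n%:R^-1) (fun=> b)).
- near=> n.
  have n0 : (0 : R) < n%:R.
    by rewrite ltr0n; near: n; exact: nbhs_infty_gt.
  have /andP[lo hi] := truncn_itv (mulr_ge0 (ltW n0) b0).
  have n0' := lt0r_neq0 n0.
  apply/andP; split; rewrite -(ler_pM2l n0); last by rewrite mulVKf.
  by rewrite mulrBr mulVKf // mulfV // lerBlDr natr1 ltW.
- have := cvgB (cvg_cst b) cvg_inv_nat; rewrite subr0; exact.
- exact: cvg_cst.
Unshelve. all: by end_near. Qed.

Lemma cvg_real_complex (u : nat -> R) (l : R) :
  (u @ \oo --> l)%classic ->
  ((fun n => (u n)%:C%C : (R[i] : numFieldType)) @ \oo -->
    (l%:C%C : (R[i] : numFieldType)))%classic.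
Proof.
move=> ul; apply/cvgrPdist_lt => -[e e'] e0.
(* A positive complex number is real, so the radius comes from [R]. *)
have e'0 : e' = 0.
  by move: e0; rewrite ltcE /= => /andP[/eqP].
rewrite e'0 in e0 *; have {}e0 : 0 < e by rewrite -ltcR.
move/cvgrPdist_lt: ul => /(_ e e0); apply: filterS => n.
rewrite -rmorphB normc_def /= expr0n addr0 sqrtr_sqr.
by rewrite ltcR.
Qed.

(** Coefficients are compared: reversal matches the tuples of one sum with the words of the
    other. *)
Lemma cycle_sum_words (I : eqType) (L : I -> seq nat) (i : I)
    (r : I -> nat) (a b : R) (n : nat) : 0 <= a ->
  (forall j, uniq (L j)) -> L i = interval_points a b n ->
  cycle_sum (r i) a b n =
  cycle_elt L r ((Num.sqrt n%:R^-1)%:C)%C i.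
Proof.
move=> a0 LU LiE; apply/malgP => g.
rewrite [RHS]mcoeff_cycle_elt.
rewrite mcoeffZ raddf_sum /=.
congr (_ * _).
  rewrite -rmorphXn; congr (_%:C)%C.
  have n1 : (n%:R : R)^-1 >= 0 by rewrite invr_ge0.
  rewrite -powR12_sqrt // -powR_mulrn ?powR_ge0 // -powRrM.
  by rewrite -(powR_inv1 (ler0n R n)) -powRrM mulN1r [_ * _%:R]mulrC.
set K := Num.truncn _; set D := fun k => _ && _.
pose val_rev (s : (r i).-tuple 'I_K.+1) := rev (map val s).
transitivity (\sum_(w <- [seq val_rev s | s : (r i).-tuple 'I_K.+1 <-
    index_enum _ & uniq s && all D s]) (star_perm w == g)%:R : R[i]).
  rewrite big_map big_filter; apply: eq_bigr => s /andP[sU /allP sL].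
  rewrite mcoeffU cycle_star_perm //= map_inj_uniq; last exact: val_inj.
  rewrite sU andbT; apply/mapP => -[k ks k0].
  have /andP[+ _] := sL k ks.
  by rewrite (esym k0 : nat_of_ord k = 0%N) ltNge mulr_ge0.
rewrite -[RHS]big_filter; apply: perm_big; apply: uniq_perm.
- rewrite map_inj_uniq ?filter_uniq ?index_enum_uniq // => s1 s2.
  by move=> /(can_inj revK) /(inj_map val_inj) /val_inj.
- exact/filter_uniq/words_uniq.
move=> w; rewrite mem_filter mem_words_nseq LiE.
apply/mapP/and3P => [[s]|[wU /eqP ws /allP wL]].
  rewrite mem_filter => /andP[/andP[sU /allP sL] _] ->.
  rewrite rev_uniq (map_inj_uniq val_inj) size_rev size_map size_tuple sU.
  split=> //; apply/allP => k; rewrite mem_rev => /mapP[x xs ->].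
  by rewrite inE mem_interval_points; exact: sL.
have wK k : k \in w -> (k < K.+1)%N.
  by move=> /wL; rewrite inE mem_filter mem_iota add0n => /andP[_].
have wE : map val (map (inord : nat -> 'I_K.+1) (rev w)) = rev w.
  rewrite -map_comp -[RHS]map_id; apply/eq_in_map => k.
  by rewrite mem_rev => /wK kK /=; rewrite inordK.
have sP : size (map (inord : nat -> 'I_K.+1) (rev w)) == r i.
  by rewrite size_map size_rev ws.
exists (Tuple sP); last by rewrite /val_rev /= wE revK.
rewrite mem_filter mem_index_enum andbT; apply/andP; split.
  by rewrite -(map_inj_uniq val_inj) wE rev_uniq.
apply/allP => k ks.
have : val k \in rev w by rewrite -wE map_f.
by rewrite mem_rev => /wL; rewrite inE mem_interval_points.
Qed.

End Intervals.

Theorem corollary1 (R : realType) (p : nat) (r : 'I_p -> nat)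
    (t : 'I_p.+1 -> R) (hp : (1 <= p)%N)
    (ht0 : 0 <= t ord0)
    (ht : forall i j : 'I_p.+1, (i < j)%N -> t i < t j) :
  asymptotically_free (fun (n : nat) (i : 'I_p) =>
    cycle_sum (r i) (t (widen_ord (leqnSn p) i)) (t (lift ord0 i)) n).
Proof.
have tle (i j : 'I_p.+1) : (i <= j)%N -> t i <= t j.
  rewrite leq_eqVlt => /predU1P[/val_inj->//|/ht]; exact: ltW.
have t0 j : 0 <= t j by exact: le_trans ht0 (tle _ _ _).
set a := fun i : 'I_p => t (widen_ord (leqnSn p) i).
set b := fun i : 'I_p => t (lift ord0 i).
have ab i : a i <= b i by apply: tle; rewrite /= /bump leq0n add1n.
pose L n i := interval_points (a i) (b i) n.
(* This is [n^(-1/2)]; at [n = 0] it takes the default value [0]. *)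
pose q n : R[i] := ((Num.sqrt n%:R^-1)%:C)%C.
have LU n i : uniq (L n i) by rewrite filter_uniq ?iota_uniq.
(* For [i < j] the right end of the interval of [i] is at most the left end of that of [j]. *)
have Ldisj_lt n (i j : 'I_p) x : (i < j)%N -> x \in L n i -> x \notin L n j.
  move=> ij; rewrite !mem_interval_points => /andP[_ xb].
  rewrite negb_and -leNgt; apply/orP; left; apply: le_trans xb _.
  by apply: ler_wpM2l => //; apply: tle; rewrite /= /bump leq0n add1n.
have Ldisj n i j x : x \in L n i -> x \in L n j -> i = j.
  move=> xi xj; apply/val_inj; case: (ltngtP i j) => // ij.
    by have := Ldisj_lt n i j x ij xi; rewrite xj.
  by have := Ldisj_lt n j i x ij xj; rewrite xi.
have L0 n i : 0%N \notin L n i.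
  by rewrite mem_interval_points ltNge mulr_ge0 ?t0.
have q0 : (q @ \oo --> (0 : (R[i] : numFieldType)))%classic.
  apply: cvg_real_complex; rewrite -[X in (_ --> X)%classic]sqrtr0.
  apply: continuous_cvg; [exact: sqrt_continuous|exact: cvg_inv_nat].
(* The number of points divided by [n] tends to the length of the interval. *)
have Llen i : ((fun n => q n ^+ 2 * (size (L n i))%:R) @ \oo -->
    ((b i - a i)%:C%C : (R[i] : numFieldType)))%classic.
  have E n : q n ^+ 2 * (size (L n i))%:R =
      (n%:R^-1 * (Num.truncn (n%:R * b i))%:R -
       n%:R^-1 * (Num.truncn (n%:R * a i))%:R)%:C%C.
    rewrite size_interval_points ?t0 // natrB; last first.
      by apply: le_truncn; rewrite ler_wpM2l.
    rewrite -mulrBr rmorphM -rmorphXn sqr_sqrtr ?invr_ge0 //.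
    by rewrite rmorphB !rmorph_nat.
  under eq_fun do rewrite E.
  by apply: cvg_real_complex; apply: cvgB; apply: cvg_truncn; exact: t0.
have ME : (fun n i => cycle_sum (r i) (a i) (b i) n) =
    (fun n i => cycle_elt (L n) r (q n) i).
  apply/funext => n; apply/funext => i.
  by apply: cycle_sum_words => //; exact: t0.
rewrite [X in asymptotically_free X]ME.
apply: asymptotically_free_of_limits.
- move=> n i; rewrite -(congr1 (fun f => f n i) ME).
  by apply: cycle_sum_adj; exact: t0.
- move=> s; exact: (cycle_elt_moment_cvg r LU Ldisj L0 q0 Llen).
- move=> s sn ss; exact: (cycle_elt_free r LU Ldisj L0 q0 Llen).
Qed.
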